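(* Let $L\in PC^1([a,b]\times\mathbb{R}^n\times\mathbb{R}^n;\mathbb{R})$, written $L(t,x,u)$, and let $x_a,x_b\in\mathbb{R}^n$. Consider the problem of finding a piecewise continuously differentiable curve $x:[a,b]\to\mathbb{R}^n$ solution of $$\mathcal{J}[x(\cdot)]=\int_a^b w(t)\,L\bigl(t,x(t),{}^{A}_{C}D^{\alpha,\beta}_{a+}x(t)\bigr)dt\longrightarrow\max\quad\text{subject to}\quad x(a)=x_a,\ x(b)=x_b,$$ where $w(t)=\dfrac{(b-t)^{\alpha-1}A\bigl((b-t)^{\beta}\bigr)}{\Gamma(\alpha)A(1)}$. If $x^{*}$ is a solution to this problem, then it satisfies the Euler--Lagrange equation $${}^{A}_{RL}D^{\alpha,\beta}_{b-}\Bigl[w(t)\nabla_uL\bigl(t,x^{*}(t),{}^{A}_{C}D^{\alpha,\beta}_{a+}x^{*}(t)\bigr)\Bigr]+w(t)\nabla_xL\bigl(t,x^{*}(t),{}^{A}_{C}D^{\alpha,\beta}_{a+}x^{*}(t)\bigr)=0,\qquad t\in[a,b].$$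
   Context: $PC^1$ denotes piecewise continuously differentiable functions; $\nabla_xL$ and $\nabla_uL$ are the gradients of $L$ with respect to its second and third arguments. Let $[a,b]$ be a real interval, $\alpha\in[0,1]$ a real parameter, $\beta$ a complex parameter with non-negative real part, and $R$ a positive number with $R>(b-a)^{\mathrm{Re}(\beta)}$. Let $A$ be a complex analytic function on the disc $D(0,R)$, given there by the locally uniformly convergent power series $A(x)=\sum_{n=0}^{\infty}a_nx^n$. The left and right-sided fractional integrals of order $\alpha$ with general analytic kernel $A$ are $${}^{A}I^{\alpha,\beta}_{a+}x(t)=\int_a^t(t-s)^{\alpha-1}A\bigl((t-s)^{\beta}\bigr)x(s)\,ds,\qquad {}^{A}I^{\alpha,\beta}_{b-}x(t)=\int_t^b(s-t)^{\alpha-1}A\bigl((s-t)^{\beta}\bigr)x(s)\,ds.$$ For an analytic function $A$ used in an operator of order $\alpha$, put $A_\Gamma(x)=\sum_{n\ge0}a_n\Gamma(\beta n+\alpha)x^n$. Let $\bar A(x)=\sum_{n\ge0}\bar a_nx^n$ be the analytic function with $A_\Gamma\cdot\bar A_\Gamma=1$, where, $\bar A$ being used in operators of order $1-\alpha$, $\bar A_\Gamma(x)=\sum_{n\ge0}\bar a_n\Gamma(\beta n+1-\alpha)x^n$. The left Caputo and right Riemann--Liouville fractional derivatives with general analytic kernel are $${}^{A}_{C}D^{\alpha,\beta}_{a+}x(t)={}^{\bar A}I^{1-\alpha,\beta}_{a+}x'(t),\qquad {}^{A}_{RL}D^{\alpha,\beta}_{b-}x(t)=-\frac{d}{dt}\Bigl({}^{\bar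 A}I^{1-\alpha,\beta}_{b-}x(t)\Bigr),$$ acting componentwise on vector-valued functions. *)

(* Defs.v *)
From mathcomp Require Import all_boot all_order all_algebra.
From mathcomp Require Import all_classical all_reals all_analysis.
From mathcomp.real_closed Require Export complex.

Set Implicit Arguments.
Unset Strict Implicit.
Unset Printing Implicit Defensive.

Import Order.TTheory GRing.Theory Num.Theory.
Import numFieldNormedType.Exports.

Local Open Scope classical_set_scope.
Local Open Scope ring_scope.
Local Open Scope complex_scope.

(* R[i] carries its topology under the alias R[i]^o. *)

Section ComplexAnalysis.
Variable R : realType.
Implicit Types (s t a b alpha : R) (z beta : R[i]).

(* Principal power of a positive real base. *)
Definition cpow s z : R[i] :=
  (s `^ complex.Re z)%:C * (cos (complex.Im z * ln s) +i* sin (complex.Im z * ln s)).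

(* Gauss' product formula, valid on the whole plane minus the poles
   0, -1, -2, ...; at a pole the quotient is eventually 0 (as x / 0 = 0), so
   that Gamma takes there the conventional value 0. *)
Definition Gamma z : R[i] :=
  lim ((fun n : nat =>
    (n`!%:R * cpow n%:R z / \prod_(k < n.+1) (z + k%:R) : R[i]^o)) @ \oo).

(* Locally uniform convergence on the open disc D(0, rho), in the form of
   uniform convergence on the smaller closed discs. *)
Definition has_power_series (rho : R) (A : R[i] -> R[i]) (c : nat -> R[i]) :=
  forall r : R, 0 < r < rho ->
    {uniform [set z : R[i] | `|z| <= r%:C],
      (fun (N : nat) (z : R[i]) => (\sum_(n < N) c n * z ^+ n : R[i]^o)) @ \oo
      --> (A : R[i] -> R[i]^o)}.

Definition Gamma_coef alpha beta (c : nat -> R[i]) (n : nat) : R[i] :=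
  c n * Gamma (beta * n%:R + alpha%:C).

(* A_Gamma * Abar_Gamma = 1 as a product of power series in x (A_Gamma may
   have radius of convergence 0). For alpha = 0 or alpha = 1 a factor
   Gamma(0) occurs in the constant term, and no Abar exists. *)
Definition Gamma_inverse alpha beta (c cbar : nat -> R[i]) :=
  forall n : nat,
    \sum_(k < n.+1) Gamma_coef alpha beta c k *
                    Gamma_coef (1 - alpha) beta cbar (n - k)%N = (n == 0%N)%:R.

Definition Cintegral (D : set R) (f : R -> R[i]) : R[i] :=
  (\int[lebesgue_measure]_(s in D) complex.Re (f s)) +i*
  (\int[lebesgue_measure]_(s in D) complex.Im (f s)).

Definition kernel alpha beta (A : R[i] -> R[i]) s : R[i] :=
  (s `^ (alpha - 1))%:C * A (cpow s beta).

Definition left_integral a alpha beta (A : R[i] -> R[i]) (x : R -> R[i]) t :=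
  Cintegral `[a, t] (fun s => kernel alpha beta A (t - s) * x s).

Definition right_integral b alpha beta (A : R[i] -> R[i]) (x : R -> R[i]) t :=
  Cintegral `[t, b] (fun s => kernel alpha beta A (s - t) * x s).

(* f has derivative d at t as a function on [a, b]; one-sided at end points. *)
Definition derivative_on a b (f : R -> R[i]) t (d : R[i]) :=
  (fun s => ((s - t)^-1)%:C * (f s - f t) : R[i]^o) @ within `[a, b] t^'
    --> (d : R[i]^o).

Definition caputo_left (n : nat) a alpha beta (Abar : R[i] -> R[i])
    (x : R -> 'rV[R]_n) t : 'rV[R[i]]_n :=
  \row_i left_integral a (1 - alpha) beta Abar
           (fun s => (derive1 x s 0 i)%:C) t.

(* The right Riemann-Liouville derivative of y exists at t and equals d. *)
Definition is_RL_right (n : nat) a b alpha beta (Abar : R[i] -> R[i])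
    (y : R -> 'rV[R[i]]_n) t (d : 'rV[R[i]]_n) :=
  forall i : 'I_n,
    derivative_on a b
      (right_integral b (1 - alpha) beta Abar (fun s => y s 0 i)) t (- d 0 i).

Definition weight b alpha beta (A : R[i] -> R[i]) t : R[i] :=
  kernel alpha beta A (b - t) / (Gamma alpha%:C * A 1).

End ComplexAnalysis.

(* f is continuous on the part tau^-1([a, b]) of its domain, and [a, b] has a
   partition such that f is C^1 up to the boundary on tau^-1([c, d]) for each
   of its subintervals [c, d]: every directional derivative exists over ]c, d[
   and extends continuously to [c, d]. *)
Definition PC1 (R : realType) (V W : normedModType R) (tau : V -> R) (a b : R)
    (f : V -> W) :=
  {within tau @^-1` `[a, b], continuous f} /\
  exists2 s : seq R, itv_partition a b s &
    forall i : nat, (i < size s)%N ->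
      let c := nth b (a :: s) i in let d := nth b s i in
      forall v : V, exists2 g : V -> W,
        {within tau @^-1` `[c, d], continuous g} &
        forall p : V, c < tau p < d -> is_derive p v f (g p).

Definition PC1_curve (R : realType) (n : nat) (a b : R) (x : R -> 'rV[R]_n) :=
  @PC1 R R^o 'rV[R]_n id a b x.

Definition PC1_lagrangian (R : realType) (n : nat) (a b : R)
    (L : R -> 'rV[R]_n -> 'rV[R]_n -> R) :=
  @PC1 R (R^o * 'rV[R]_n * 'rV[R]_n)%type R^o (fun p => p.1.1) a b
    (fun p => L p.1.1 p.1.2 p.2).

Section Variational.
Variables (R : realType) (n : nat).
Implicit Types (L : R -> 'rV[R]_n -> 'rV[R]_n -> R).

Definition gradient (f : 'rV[R]_n -> R) (p : 'rV[R]_n) : 'rV[R]_n :=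
  \row_i 'D_(delta_mx 0 i) (f : 'rV[R]_n -> R^o) p.

Definition gradx L t x u := gradient (fun y => L t y u) x.
Definition gradu L t x u := gradient (fun v => L t x v) u.

(* The Caputo derivative when it is R^n-valued, i.e. when the kernel of the
   operator is real. *)
Definition caputo_real (a alpha : R) (beta : R[i]) (Abar : R[i] -> R[i])
    (x : R -> 'rV[R]_n) t : 'rV[R]_n :=
  map_mx (@complex.Re R) (caputo_left a alpha beta Abar x t).

Definition functional (a b alpha : R) (beta : R[i]) (A Abar : R[i] -> R[i]) L
    (x : R -> 'rV[R]_n) : R[i] :=
  Cintegral `[a, b] (fun t =>
    weight b alpha beta A t * (L t (x t) (caputo_real a alpha beta Abar x t))%:C).

Definition admissible (a b : R) (xa xb : 'rV[R]_n) (x : R -> 'rV[R]_n) :=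
  [/\ PC1_curve a b x, x a = xa & x b = xb].

(* z <= z' in R[i] means that z' - z is a nonnegative real, so this is the
   usual maximality when the functional is real-valued. *)
Definition is_solution (a b alpha : R) (beta : R[i]) (A Abar : R[i] -> R[i]) L
    (xa xb : 'rV[R]_n) (x : R -> 'rV[R]_n) :=
  admissible a b xa xb x /\
  forall y, admissible a b xa xb y ->
    functional a b alpha beta A Abar L y <= functional a b alpha beta A Abar L x.

End Variational.

(* Main.v *)
From HB Require Import structures.
Require Import Defs.
From mathcomp Require Import all_boot all_order all_algebra.
From mathcomp Require Import all_classical all_reals all_analysis measurable_realfun.
From mathcomp.real_closed Require Import complex.
From mathcomp Require Import ring lra.

(* Gamma(0) = 0 makes the inverse relation impossible at the orders 0 and 1, so
   0 < alpha < 1 and both kernels are integrable. Comparison in R[i] fixes the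
   imaginary parts, so x maximizes the functional for each of the real weights
   Re w and Im w, and it is enough to treat a real weight w.

   Perturb x by eta e_i and write K for the real kernel of the Caputo operator.
   Dominated convergence gives
     int_a^b w (dL/dx_i eta + dL/du_i (K * eta')) = 0,
   and Fubini turns this into int_a^b eta' (P + Q) = 0, where
     P(s) = int_s^b K(t - s) w(t) dL/du_i dt,   Q(s) = int_s^b w dL/dx_i.
   P + Q is continuous on [a, b) (P need not be continuous at b), so by du
   Bois-Reymond it is constant there, whence P' = - Q' = w dL/dx_i.

   The break points of L do no harm: a derivative of L in a direction that fixes
   t is determined by the slice at t, so it agrees from both sides. *)

Set Implicit Arguments.
Unset Strict Implicit.
Unset Printing Implicit Defensive.

Import Order.TTheory GRing.Theory Num.Theory.
Import numFieldNormedType.Exports.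

Local Open Scope classical_set_scope.
Local Open Scope ring_scope.

(** * Lebesgue integrals on the line *)

(** Both factors under the integral defining P are singular: K(r) may blow up like r^(-alpha) at 0,
    and w(t) like (b - t)^(alpha - 1) at b. The exponents add up to -1. In the model case of
    constant A and Abar, the integral of K(t - s) w(t) over t in [s, b] is, up to a factor,
    Gamma(alpha) Gamma(1 - alpha) for every s < b, and it is 0 for s = b. This is the jump of P at
    b, and the reason why the equation is obtained for t < b. For s < b the two singularities stay
    apart, which is what makes P continuous there.

    Dominated convergence in the first variation needs difference quotients of L that are bounded
    uniformly in t. The bound comes from the continuity of the Caputo derivative: it is the
    convolution of the integrable K with x', which is bounded and continuous off finitely many
    points. Hence (t, x(t), u(t)) and its small perturbations stay in a compact set, on which the
    partial derivatives of L are bounded, and the integrability of w suffices. *)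

Section LebesgueInvariance.
Variable R : realType.
Local Notation mu := (@lebesgue_measure R).
Implicit Types (f g k p : R -> R).

(** Lebesgue measure is the only measure giving every half-open interval its length, so [phi] has to
    be tested on such intervals only. *)
Lemma lebesgue_pushforward (phi : R -> R) (mphi : measurable_fun setT phi) :
  (forall u v, u < v -> mu (phi @^-1` `]u, v]%classic) = (v - u)%:E) ->
  forall A, measurable A -> pushforward mu phi A = mu A.
Proof.
move=> H A mA.
have mphi' : measurable_fun (setT : set (measurableTypeR R))
  (phi : measurableTypeR R -> measurableTypeR R) by exact: mphi.
pose pm : {measure set (measurableTypeR R) -> \bar R} :=
  measure_function_pushforward__canonical__measure_function_Measure mu mphi'.
rewrite (@lebesgue_measure_unique R pm)//.
move=> X [[u v] _ <-]; rewrite /pushforward/=.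
case: (ltP u v) => uv.
  by rewrite [LHS]lebesgue_measure_itv/= lte_fin uv -EFinB -(H _ _ uv).
by rewrite set_itv_ge ?bnd_simp -?leNgt// preimage_set0 !measure0.
Qed.

Lemma integral_lebesgue_preserving (phi : R -> R) (f : R -> \bar R) :
  measurable_fun setT phi ->
  (forall u v, u < v -> mu (phi @^-1` `]u, v]%classic) = (v - u)%:E) ->
  measurable_fun setT f ->
  (mu.-integrable setT f -> mu.-integrable setT (f \o phi)) /\
  (mu.-integrable setT f -> (\int[mu]_x f (phi x) = \int[mu]_x f x)%E) /\
  ((forall x, 0 <= f x)%E -> (\int[mu]_x f (phi x) = \int[mu]_x f x)%E).
Proof.
move=> mphi Hphi mf.
have pE := lebesgue_pushforward mphi Hphi.
have mphi' : measurable_fun (setT : set (measurableTypeR R))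
  (phi : measurableTypeR R -> measurableTypeR R) by exact: mphi.
pose pm : {measure set (measurableTypeR R) -> \bar R} :=
  measure_function_pushforward__canonical__measure_function_Measure mu mphi'.
(* The nonnegative case goes first: applied to the absolute value of [f], it yields the
   integrability of [f \o phi], which the change of variables for integrable functions requires. *)
have ge0 (h : R -> \bar R) : measurable_fun setT h -> (forall x, 0 <= h x)%E ->
    (\int[mu]_x h (phi x) = \int[mu]_x h x)%E.
  move=> mh h0; rewrite -[LHS](@ge0_integral_pushforward _ _ _ _ R _ mphi' mu setT h)//.
  by apply: (@eq_measure_integral _ _ _ _ mu pm) => A mA _; exact: (pE A mA).
have ifphi : mu.-integrable setT f -> mu.-integrable setT (f \o phi).
  move=> /integrableP[_ foo]; apply/integrableP; split; first exact: measurableT_comp.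
  by rewrite (ge0 (fun x => `|f x|%E))//; exact: measurableT_comp.
split=> //; split => [intf|]; last exact: ge0.
rewrite -[LHS](@integral_pushforward _ _ _ _ R _ mphi' mu setT f)//; last exact: ifphi.
by apply: (@eq_measure_integral _ _ _ _ mu pm) => A mA _; exact: (pE A mA).
Qed.

Lemma preimage_shift (c u v : R) : u < v ->
  mu ((fun x : R => x + c) @^-1` `]u, v]%classic) = (v - u)%:E.
Proof.
move=> uv.
have -> : (fun x : R => x + c) @^-1` `]u, v]%classic = `]u - c, v - c]%classic.
  by apply/seteqP; split => x /=; rewrite !in_itv/= ltrBlDr lerBrDr.
by rewrite lebesgue_measure_itv/= lte_fin ltrD2r uv -EFinB; congr (_%:E); ring.
Qed.

Lemma preimage_reflect (c u v : R) : u < v ->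
  mu ((fun x : R => c - x) @^-1` `]u, v]%classic) = (v - u)%:E.
Proof.
move=> uv.
have -> : (fun x : R => c - x) @^-1` `]u, v]%classic = `[c - v, c - u[%classic.
  apply/seteqP; split => x /=; rewrite !in_itv/= => /andP[]; first by lra.
  by move=> ? ?; apply/andP; split; lra.
rewrite lebesgue_measure_itv/= lte_fin ltrD2l ltrN2 uv -EFinB.
by congr (_%:E); ring.
Qed.

Lemma integrable_shift (c : R) f : mu.-integrable setT (EFin \o f) ->
  mu.-integrable setT (EFin \o (fun x => f (x + c))).
Proof.
move=> intf; have mf := measurable_int _ intf.
have [+ _] := @integral_lebesgue_preserving (fun x => x + c) (EFin \o f)
  (measurable_funD (@measurable_id _ _ _) (measurable_cst c))
  (@preimage_shift c) mf.
exact.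
Qed.

Lemma integrable_reflect (c : R) f : mu.-integrable setT (EFin \o f) ->
  mu.-integrable setT (EFin \o (fun x => f (c - x))).
Proof.
move=> intf; have mf := measurable_int _ intf.
have [+ _] := @integral_lebesgue_preserving (fun x => c - x) (EFin \o f)
  (measurable_funB (measurable_cst c) (@measurable_id _ _ _))
  (@preimage_reflect c) mf.
exact.
Qed.

Lemma Rintegral_shift (c : R) f : mu.-integrable setT (EFin \o f) ->
  \int[mu]_x f (x + c) = \int[mu]_x f x.
Proof.
move=> intf; have mf := measurable_int _ intf.
have [_ [+ _]] := @integral_lebesgue_preserving (fun x => x + c) (EFin \o f)
  (measurable_funD (@measurable_id _ _ _) (measurable_cst c))
  (@preimage_shift c) mf.
by rewrite /Rintegral => <-.
Qed.

Lemma ge0_integral_reflect (c : R) (f : R -> \bar R) : measurable_fun setT f ->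
  (forall x, 0 <= f x)%E -> (\int[mu]_x f (c - x)%R = \int[mu]_x f x)%E.
Proof.
move=> mf; have [_ [_]] := @integral_lebesgue_preserving (fun x => c - x) f
  (measurable_funB (measurable_cst c) (@measurable_id _ _ _))
  (@preimage_reflect c) mf.
exact.
Qed.

Lemma Rintegral_dct (D : set R) (f_ : nat -> R -> R) f g : measurable D ->
  (forall n, measurable_fun D (f_ n)) -> measurable_fun D f ->
  {ae mu, forall x, D x -> f_ ^~ x @ \oo --> f x} ->
  mu.-integrable D (EFin \o g) ->
  (forall n x, D x -> `|f_ n x| <= g x) ->
  \int[mu]_(x in D) f_ n x @[n --> \oo] --> \int[mu]_(x in D) f x.
Proof.
move=> mD mf_ mf f_f intg f_g.
have [intf _ H] : [/\ mu.-integrable D (EFin \o f),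
   [sequence \int[mu]_(x in D) `|((EFin \o f_ n) x - (EFin \o f) x)|]_n%E @ \oo --> 0%E &
   [sequence \int[mu]_(x in D) ((EFin \o f_ n) x)]_n%E @ \oo -->
     (\int[mu]_(x in D) (EFin \o f) x)%E ].
  apply: (@dominated_convergence _ _ _ mu D mD _ _ (EFin \o g)) => //.
  - by move=> n; apply/measurable_EFinP; exact: mf_.
  - by apply/measurable_EFinP; exact: mf.
  - move: f_f; apply: filterS; first exact: (ae_filter_ringOfSetsType mu).
    move=> x /= + Dx => /(_ Dx) ff.
    by apply/fine_cvgP; split; [exact: nearW|exact: ff].
  - by apply/aeW => x n Dx; rewrite lee_fin f_g.
apply: fine_cvg; rewrite fineK; first exact: H.
exact: integrable_fin_num.
Qed.

End LebesgueInvariance.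

(** * Cross-correlation integrals: continuity and exchange of integrals *)

Section Convolution.
Variable R : realType.
Local Notation mu := (@lebesgue_measure R).
Implicit Types (f g k p : R -> R).

Lemma near_eq_continuous f g (x : R) : (\forall y \near x, f y = g y) ->
  {for x, continuous f} -> {for x, continuous g}.
Proof.
move=> fg cf; rewrite /prop_for /continuous_at -(nbhs_singleton fg).
by apply: cvg_trans cf; exact: near_eq_cvg.
Qed.

Lemma ae_finite_set (N : set R) (P : R -> Prop) : finite_set N ->
  (forall x, ~ N x -> P x) -> {ae mu, forall x, P x}.
Proof.
move=> fN NP; exists N; split.
- exact: countable_measurable (finite_set_countable fN).
- exact: countable_lebesgue_measure0 (finite_set_countable fN).
- by move=> x /= nP; apply: contrapT => /NP.
Qed.

Lemma ae_imp (P Q : R -> Prop) : (forall x, P x -> Q x) ->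
  {ae mu, forall x, P x} -> {ae mu, forall x, Q x}.
Proof.
move=> PQ [N [mN N0 sN]]; exists N; split=> // x nQ.
by apply: sN => Px; apply: nQ; exact: PQ.
Qed.

Lemma integrable_boundedM (D : set R) f g (M : R) : measurable D ->
  measurable_fun D f -> (forall x, D x -> `|f x| <= M) ->
  mu.-integrable D (EFin \o g) -> mu.-integrable D (EFin \o (fun x => f x * g x)).
Proof.
move=> mD mf fM ig.
apply: (@le_integrable _ _ _ mu _ mD _ (fun x => M%:E * (EFin \o g) x)%E).
- apply/measurable_EFinP/measurable_funM => //; apply/measurable_EFinP.
  exact: measurable_int ig.
- move=> x Dx /=; rewrite lee_fin !normrM ler_wpM2r//.
  by rewrite (le_trans (fM _ Dx))// ler_norm.
- exact: integrableZl.
Qed.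

(** The parameter s enters through the bounded factor alone, so M |g| dominates for all s at once,
    and pointwise convergence fails only for t in a translate of the finite set [N]. *)
Lemma continuous_Rintegral_translate f g (M c : R) (N : set R) :
  measurable_fun setT f -> (forall x, `|f x| <= M) -> finite_set N ->
  (forall x, ~ N x -> {for x, continuous f}) ->
  mu.-integrable setT (EFin \o g) ->
  continuous (fun s : R => \int[mu]_t (f (t + c * s) * g t)).
Proof.
move=> mf fM fN cf ig s.
have mg : measurable_fun setT g by apply/measurable_EFinP; exact: measurable_int ig.
have mfs (u : R) : measurable_fun setT (fun t : R => f (t + c * u) * g t).
  apply: measurable_funM => //; apply: measurableT_comp => //.
  exact: measurable_funD.
apply/(@cvg_nbhsP _ R^o) => w ws.
apply: (@Rintegral_dct _ setT _ _ (fun t => M * `|g t|)) => //.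
- apply: (@ae_finite_set ((fun y => y - c * s) @` N)).
    exact: finite_image.
  move=> t Nt _; apply: cvgM; last exact: cvg_cst.
  have ct : {for t + c * s, continuous f}.
    by apply: cf => Nts; apply: Nt; exists (t + c * s) => //; rewrite addrK.
  apply: (cvg_comp (fun n => t + c * w n) f _ ct).
  by apply: cvgD; [exact: cvg_cst|apply: cvgM => //; exact: cvg_cst].
- apply: (@integrable_boundedM setT (fun=> M) (fun t => `|g t|) `|M|) => //.
  exact: integrable_norm.
- by move=> n x _; rewrite normrM ler_wpM2r.
Qed.

(** The substitution r = t - s moves the parameter from [k], which may be singular, to [p], where
    dominated convergence can use it. *)
Lemma Rintegral_cross_shift k p (s : R) :
  mu.-integrable setT (EFin \o (fun t => k (t - s) * p t)) ->
  \int[mu]_t (k (t - s) * p t) = \int[mu]_r (p (r + 1 * s) * k r).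
Proof.
move=> ikp; rewrite -(Rintegral_shift s ikp).
by apply: eq_Rintegral => r _; rewrite addrK mul1r mulrC.
Qed.

Lemma continuous_cross k p (M : R) (N : set R) :
  measurable_fun setT p -> (forall x, `|p x| <= M) -> finite_set N ->
  (forall x, ~ N x -> {for x, continuous p}) ->
  mu.-integrable setT (EFin \o k) ->
  continuous (fun s : R => \int[mu]_t (k (t - s) * p t)).
Proof.
move=> mp pM fN cp ik.
rewrite (_ : (fun s => _) = (fun s : R => \int[mu]_r (p (r + 1 * s) * k r))).
  exact: continuous_Rintegral_translate cp ik.
apply/funext => s; apply: Rintegral_cross_shift.
rewrite (_ : EFin \o _ = EFin \o (fun t => p t * k (t - s))).
  apply: (@integrable_boundedM setT p _ M) => //.
  exact: (integrable_shift (- s)).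
by apply/funext => t /=; rewrite mulrC.
Qed.

(* k is singular at 0 and p beyond m: split p at m, translate the integral with
   the part below m, and truncate k at d in the other one. *)
Lemma continuous_cross_singular k p (d m : R) (M B : R) (N : set R) :
  0 < d ->
  mu.-integrable setT (EFin \o k) -> mu.-integrable setT (EFin \o p) ->
  finite_set N ->
  (forall r, d <= r -> `|k r| <= B) ->
  (forall r, ~ N r -> {for r, continuous k}) ->
  (forall t, t < m -> `|p t| <= M) ->
  (forall t, ~ N t -> t < m -> {for t, continuous p}) ->
  forall s, s < m - d -> {for s, continuous (fun s : R => \int[mu]_t (k (t - s) * p t))}.
Proof.
move=> d0 ik ip fN kB ck pM cp s sm.
have mk : measurable_fun setT k by apply/measurable_EFinP; exact: measurable_int ik.
have mp : measurable_fun setT p by apply/measurable_EFinP; exact: measurable_int ip.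
have mI (i : interval R) : measurable_fun setT (\1_[set` i] : R -> R).
  exact: measurable_indic.
pose p1 t := p t * \1_`]-oo, m[ t.
pose p2 t := \1_`[m, +oo[ t * p t.
pose k2 t := k t * \1_`[d, +oo[ t.
have pE t : p t = p1 t + p2 t.
  rewrite /p1 /p2 !indicE !mem_setE !in_itv/= andbT.
  by case: ltP => _; rewrite ?(mulr1, mul1r, mulr0, mul0r, addr0, add0r).
have ip1 : mu.-integrable setT (EFin \o p1).
  rewrite (_ : p1 = fun t => \1_`]-oo, m[ t * p t); last first.
    by apply/funext => t; rewrite /p1 mulrC.
  apply: (@integrable_boundedM setT _ p 1) => // x _.
  by rewrite indicE; case: (_ \in _); rewrite /= ?normr1 ?normr0.
have ip2 : mu.-integrable setT (EFin \o p2).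
  apply: (@integrable_boundedM setT _ p 1) => // x _.
  by rewrite indicE; case: (_ \in _); rewrite /= ?normr1 ?normr0.
have p1M t : `|p1 t| <= `|M|.
  rewrite /p1 indicE mem_setE in_itv/=; case: ltP => tm.
    by rewrite mulr1 (le_trans (pM _ tm))// ler_norm.
  by rewrite mulr0 normr0.
have k2B r : `|k2 r| <= `|B|.
  rewrite /k2 indicE mem_setE in_itv/= andbT; case: (leP d r) => dr.
    by rewrite mulr1 (le_trans (kB _ dr))// ler_norm.
  by rewrite mulr0 normr0.
have mk2 : measurable_fun setT k2 by exact: measurable_funM.
have mp1 : measurable_fun setT p1 by exact: measurable_funM.
have fN1 : finite_set (N `|` [set m]) by rewrite finite_setU.
have fN2 : finite_set (N `|` [set d]) by rewrite finite_setU.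
have cp1 t : ~ (N `|` [set m]) t -> {for t, continuous p1}.
  move=> /not_orP[Nt /eqP]; rewrite neq_lt => /orP[tm|mt].
  - have : \forall x \near t, p x = p1 x.
      near=> x; rewrite /p1 indicE mem_setE in_itv/=.
      have -> : x < m by near: x; exact: lt_nbhsl.
      by rewrite /= mulr1.
    move=> /near_eq_continuous; apply; exact: cp.
  - have : \forall x \near t, cst 0 x = p1 x.
      near=> x; rewrite /p1 indicE mem_setE in_itv/= ltNge.
      have -> : m <= x by apply: ltW; near: x; exact: lt_nbhsr.
      by rewrite /= mulr0.
    move=> /near_eq_continuous; apply; exact: cvg_cst.
have ck2 t : ~ (N `|` [set d]) t -> {for t, continuous k2}.
  move=> /not_orP[Nt /eqP]; rewrite neq_lt => /orP[tm|mt].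
  - have : \forall x \near t, cst 0 x = k2 x.
      near=> x; rewrite /k2 indicE mem_setE in_itv/= andbT leNgt.
      have -> : x < d by near: x; exact: lt_nbhsl.
      by rewrite /= mulr0.
    move=> /near_eq_continuous; apply; exact: cvg_cst.
  - have : \forall x \near t, k x = k2 x.
      near=> x; rewrite /k2 indicE mem_setE in_itv/= andbT.
      have -> : d <= x by apply: ltW; near: x; exact: lt_nbhsr.
      by rewrite /= mulr1.
    move=> /near_eq_continuous; apply; exact: ck.
have cP1 := continuous_cross mp1 p1M fN1 cp1 ik.
have cP2 := @continuous_Rintegral_translate k2 p2 _ (-1) _ mk2 k2B fN2 ck2 ip2.
(* On the support of [p2] one has t >= m > u + d, so t - u stays above d and [k] may be replaced
   there by the bounded [k2]. *)
have PE u : u < m - d -> \int[mu]_t (k (t - u) * p t) =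
    \int[mu]_t (k (t - u) * p1 t) + \int[mu]_t (k2 (t + -1 * u) * p2 t).
  move=> um.
  have kE t : k (t - u) * p2 t = k2 (t + -1 * u) * p2 t.
    rewrite /p2 /k2 mulN1r !indicE !mem_setE !in_itv/= !andbT; case: (leP m t) => mt.
      by rewrite (_ : d <= t - u) ?mulr1//; lra.
    by rewrite !(mul0r, mulr0).
  rewrite -RintegralD//.
  - by apply: eq_Rintegral => t _; rewrite pE mulrDr kE.
  - rewrite (_ : EFin \o _ = EFin \o (fun t => p1 t * k (t - u))).
      apply: (@integrable_boundedM setT p1 _ `|M|) => //.
      exact: (integrable_shift (- u)).
    by apply/funext => t /=; rewrite mulrC.
  - apply: (@integrable_boundedM setT (fun t => k2 (t + -1 * u)) _ `|B|) => //.
    by apply: measurableT_comp => //; exact: measurable_funD.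
have : \forall u \near s,
   \int[mu]_t (k (t - u) * p1 t) + \int[mu]_t (k2 (t + -1 * u) * p2 t) =
   \int[mu]_t (k (t - u) * p t).
  near=> u; rewrite PE//; near: u; exact: lt_nbhsl.
by move=> /near_eq_continuous; apply; apply: cvgD; [exact: cP1|exact: cP2].
Unshelve. all: by end_near. Qed.

(* Tonelli, with [int |k (x - y)| dy = int |k|] for every x. *)
Lemma cross_integrable k p f (M : R) :
  mu.-integrable setT (EFin \o k) -> mu.-integrable setT (EFin \o p) ->
  measurable_fun setT f -> (forall x, `|f x| <= M) ->
  (mu \x mu)%E.-integrable setT
    (fun z : R * R => (k (z.1 - z.2) * p z.1 * f z.2)%:E).
Proof.
move=> ik ip mf fM.
have mk : measurable_fun setT k by apply/measurable_EFinP; exact: measurable_int ik.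
have mp : measurable_fun setT p by apply/measurable_EFinP; exact: measurable_int ip.
have mF : measurable_fun setT (fun z : R * R => (k (z.1 - z.2) * p z.1 * f z.2)%:E).
  apply/measurable_EFinP; apply: measurable_funM.
    apply: measurable_funM.
      apply: (measurableT_comp mk); apply: measurable_funB => //.
    exact: (measurableT_comp mp).
  exact: (measurableT_comp mf).
have mkx (x : R) : measurable_fun setT (fun y : R => k (x - y)).
  by apply: measurableT_comp => //; exact: measurable_funB.
have mkxe (x : R) : measurable_fun setT (fun y : R => `|(k (x - y))%:E|%E).
  by apply: measurableT_comp => //; apply/measurable_EFinP; exact: mkx.
have I (x : R) : (\int[mu]_y `|(k (x - y) * p x * f y)%:E| <=
    (\int[mu]_y `|(k y)%:E|) * (`|M| * `|p x|)%:E)%E.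
  rewrite -(@ge0_integral_reflect _ x (fun y => `|(k y)%:E|)%E)//; last first.
    by apply: measurableT_comp => //; apply/measurable_EFinP; exact: mk.
  rewrite -ge0_integralZr//; last exact: mkxe.
  apply: ge0_le_integral => //.
  - apply: measurableT_comp => //; apply/measurable_EFinP.
    by apply: measurable_funM => //; apply: measurable_funM => //; exact: mkx.
  - by apply: emeasurable_funM => //; exact: mkxe.
  - move=> y _; rewrite -EFinM lee_fin !normrM -mulrA ler_wpM2l//.
    by rewrite mulrC ler_wpM2r// (le_trans (fM y))// ler_norm.
have mL : measurable_fun setT
    (fun x : R => \int[mu]_y `|(k (x - y) * p x * f y)%:E|)%E.
  pose h : measurableTypeR R * measurableTypeR R -> \bar R :=
    fun z : R * R => `|(k (z.1 - z.2) * p z.1 * f z.2)%:E|%E.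
  apply: (@measurable_fun_fubini_tonelli_F _ _ _ _ R mu h).
  - exact: measurableT_comp.
  - by move=> z; rewrite /h.
have lL : (\int[mu]_x \int[mu]_y `|(k (x - y) * p x * f y)%:E| <=
    \int[mu]_x ((\int[mu]_y `|(k y)%:E|) * (`|M| * `|p x|)%:E))%E.
  apply: ge0_le_integral => //.
  - by move=> x _; exact: integral_ge0.
  - apply: emeasurable_funM => //; apply/measurable_EFinP.
    by apply: measurable_funM => //; exact: measurableT_comp.
have kfin : (\int[mu]_y `|(k y)%:E|)%E \is a fin_num.
  by apply: integrable_fin_num => //; exact: integrable_abse.
apply/integrable12ltyP; first exact: mF.
apply: (le_lt_trans lL); rewrite -(fineK kfin).
apply: integrable_lty => //.
apply: integrableZl => //.
apply: (@integrable_boundedM setT (fun=> `|M|) (fun t => `|p t|) `|M|) => //.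
  by move=> x _; rewrite normr_id.
exact: integrable_norm.
Qed.

Lemma integrable_fubini_snd (h : measurableTypeR R * measurableTypeR R -> \bar R) :
  (mu \x mu)%E.-integrable setT h ->
  mu.-integrable setT (fun s : R => \int[mu]_t h (t, s))%E.
Proof.
move=> ih; have mh := measurable_int _ ih.
apply/integrableP; split; first exact: measurable_fubini_G ih.
apply: le_lt_trans ((integrable21ltyP mu mu mh).1 ih).
apply: ge0_le_integral => //.
- exact: measurableT_comp (measurable_fubini_G ih).
- apply: (@measurable_fun_fubini_tonelli_G _ _ _ _ _ mu (abse \o h)).
    apply: measurableT_comp; [exact: abse_measurable | exact: mh].
  by move=> z; exact: abse_ge0.
- by move=> s _; apply: le_abse_integral => //; exact: measurableT_comp.
Qed.

(* The inner integral over t converges only for almost every s; elsewhere it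
   is the junk value of a divergent integral, which Fubini ignores. *)
Lemma Rintegral_cross_exchange k p f (M : R) :
  mu.-integrable setT (EFin \o k) -> mu.-integrable setT (EFin \o p) ->
  measurable_fun setT f -> (forall x, `|f x| <= M) ->
  [/\ mu.-integrable setT (EFin \o (fun s => f s * \int[mu]_t (k (t - s) * p t))),
      mu.-integrable setT (EFin \o (fun t => p t * \int[mu]_s (k (t - s) * f s))) &
  \int[mu]_t (p t * \int[mu]_s (k (t - s) * f s)) =
  \int[mu]_s (f s * \int[mu]_t (k (t - s) * p t))].
Proof.
move=> ik ip mf fM.
have mk : measurable_fun setT k by apply/measurable_EFinP; exact: measurable_int ik.
have mp : measurable_fun setT p by apply/measurable_EFinP; exact: measurable_int ip.
pose h : measurableTypeR R * measurableTypeR R -> \bar R :=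
  fun z : R * R => (k (z.1 - z.2) * p z.1 * f z.2)%:E.
have ih : (mu \x mu)%E.-integrable setT h by exact: cross_integrable fM.
have F12 := Fubini ih.
have iG := integrable_fubini_snd ih.
have ikf t : mu.-integrable setT (EFin \o (fun s => k (t - s) * f s)).
  rewrite (_ : EFin \o _ = EFin \o (fun s => f s * k (t - s))).
    apply: (@integrable_boundedM setT f _ M) => //.
    exact: (integrable_reflect t).
  by apply/funext => s /=; rewrite mulrC.
have FE t : (\int[mu]_s h (t, s) = (p t * \int[mu]_s (k (t - s) * f s))%:E)%E.
  rewrite EFinM /Rintegral fineK; last by apply: integrable_fin_num => //; exact: ikf.
  rewrite -integralZl//; last exact: ikf.
  by apply: eq_integral => s _; rewrite /h /= -EFinM; congr (_%:E); ring.
have GE : {ae mu, forall s, setT s ->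
    (\int[mu]_t h (t, s) = (f s * \int[mu]_t (k (t - s) * p t))%:E)%E}.
  apply: ae_imp (ae_integrable2 ih) => s; rewrite /h /= => ihs _.
  (* Fubini gives integrability of the section only after multiplication by [f s]. Dividing recovers
     the inner integrand, and if [f s] is 0 both sides vanish. *)
  have [fs0|fs0] := eqVneq (f s) 0.
    by rewrite fs0 mul0r; under eq_integral do rewrite mulr0; rewrite integral0.
  have iks : mu.-integrable setT (EFin \o (fun t => k (t - s) * p t)).
    rewrite (_ : EFin \o _ = EFin \o (fun t => (f s)^-1 * (k (t - s) * p t * f s))).
      by apply: (@integrable_boundedM setT (fun=> (f s)^-1) _ `|(f s)^-1|).
    by apply/funext => t /=; congr (_%:E); rewrite mulrCA mulVf// mulr1.
  rewrite EFinM /Rintegral fineK; last exact: integrable_fin_num.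
  rewrite -integralZl//.
  by apply: eq_integral => t _ /=; rewrite -EFinM; congr (_%:E); ring.
have mG : measurable_fun setT (fun s : R => (f s * \int[mu]_t (k (t - s) * p t))%:E).
  apply/measurable_EFinP; apply: measurable_funM => //.
  (* [GE] holds only almost everywhere and so does not settle measurability. With the constant 1 in
     place of [f], Fubini gives the measurability of the inner integral itself, junk values
     included. *)
  pose h1 : measurableTypeR R * measurableTypeR R -> \bar R :=
    fun z : R * R => (k (z.1 - z.2) * p z.1 * 1)%:E.
  have ih1 : (mu \x mu)%E.-integrable setT h1.
    by apply: (@cross_integrable k p (cst 1) 1) => // x; rewrite normr1.
  have : measurable_fun setT (fun s : R => \int[mu]_t h1 (t, s))%E.
    exact: measurable_int (integrable_fubini_snd ih1).
  move=> /(measurableT_comp (@fine_measurable _ setT measurableT)).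
  congr measurable_fun; apply/funext => s /=.
  by rewrite /Rintegral /h1 /=; congr fine; apply: eq_integral => t _; rewrite mulr1.
have iG' : mu.-integrable setT (EFin \o (fun s => f s * \int[mu]_t (k (t - s) * p t))).
  have mGG := measurable_int _ iG.
  apply/integrableP; split; first exact: mG.
  move/integrableP : iG => [_]; apply: le_lt_trans.
  rewrite le_eqVlt; apply/orP; left; apply/eqP.
  apply: ae_eq_integral => //.
  - by apply: measurableT_comp; [exact: abse_measurable|exact: mG].
  - by apply: measurableT_comp; [exact: abse_measurable|exact: mGG].
  - by apply: ae_imp GE => s /[apply] ->.
split; first exact: iG'.
  have := integrable_fubini_F ih; congr (_.-integrable _ _).
  by apply/funext => t; exact: FE.
rewrite [LHS]/Rintegral [RHS]/Rintegral; congr fine.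
under eq_integral do rewrite -FE.
rewrite F12; apply: ae_eq_integral => //.
exact: measurable_int iG.
Qed.

End Convolution.

(** * Integrable powers and test functions *)

Section PowersAndTents.
Variable R : realType.
Local Notation mu := (@lebesgue_measure R).

Lemma is_derive_continuous (f : R -> R) (x d : R) :
  is_derive x 1 f d -> {for x, continuous f}.
Proof. by move=> H; apply: differentiable_continuous; exact/derivable1_diffP. Qed.

Lemma FTC2_is_derive (f F : R -> R) (a b : R) : a < b ->
  (forall x, a <= x <= b -> {for x, continuous f}) ->
  (forall x, a <= x <= b -> is_derive x 1 F (f x)) ->
  (\int[mu]_(x in `[a, b]) (f x)%:E = (F b - F a)%:E)%E.
Proof.
move=> ab cf dF; rewrite (@continuous_FTC2 _ f F)//.
- apply: continuous_in_subspaceT => x; rewrite inE/= in_itv/= => xab.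
  exact: cf.
- split.
  + move=> x; rewrite in_itv/= => /andP[ax xb].
    by apply: ex_derive; apply: dF; rewrite !ltW.
  + apply: cvg_at_right_filter; apply: (@is_derive_continuous _ _ (f a)).
    by apply: dF; rewrite lexx ltW.
  + apply: cvg_at_left_filter; apply: (@is_derive_continuous _ _ (f b)).
    by apply: dF; rewrite lexx ltW.
- move=> x; rewrite in_itv/= => /andP[ax xb].
  rewrite derive1E; apply: derive_val.
  by apply: dF; rewrite !ltW.
Qed.

(** On the segments [L / (n + 1), L], away from the singularity, the primitive bounds the integral
    by L^(p + 1) / (p + 1), uniformly in n because p + 1 > 0; monotone convergence concludes. *)
Lemma integrable_powR (p L : R) : -1 < p -> 0 < L ->
  mu.-integrable `]0, L] (EFin \o (fun x => x `^ p)).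
Proof.
move=> p1 L0.
have q0 : 0 < p + 1 by lra.
have mp (A : set R) : measurable A -> measurable_fun A (fun x : R => x `^ p).
  by move=> mA; apply: measurable_funTS; exact: measurable_powR.
apply/integrableP; split; first by apply/measurable_EFinP; apply: mp; exact: measurable_itv.
pose E_ n : set R := `[L / n.+1%:R, L]%classic.
have UE : \bigcup_n E_ n = `]0, L]%classic.
  apply/seteqP; split => x /=.
    move=> [n _]; rewrite /E_ /= !in_itv/= => /andP[nx xL]; rewrite xL andbT.
    by rewrite (lt_le_trans _ nx)// divr_gt0.
  rewrite in_itv/= => /andP[x0 xL].
  exists (Num.truncn (L / x)) => //; rewrite /E_ /= in_itv/= xL andbT.
  have := truncnS_gt (L / x); rewrite ltr_pdivrMr// => /ltW.
  by rewrite ler_pdivrMr// [x * _]mulrC.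
rewrite -UE.
have H : (\int[mu]_(x in E_ n) `|(x `^ p)%:E| @[n --> \oo] -->
    \int[mu]_(x in \bigcup_n E_ n) `|(x `^ p)%:E|)%E.
  apply: ge0_nondecreasing_set_cvg_integral => //.
  - move=> m n mn; rewrite subsetEset => x; rewrite /E_ /= !in_itv/= => /andP[mx xL]; rewrite xL.
    rewrite andbT (le_trans _ mx)// ler_pM2l// lef_pV2 ?posrE// ler_nat.
    by rewrite ltnS.
  - by move=> n; exact: measurable_itv.
  - move=> n; apply: measurableT_comp => //; apply/measurable_EFinP.
    by apply: mp; exact: measurable_itv.
apply: (@le_lt_trans _ _ ((L `^ (p + 1) / (p + 1))%:E)); last by rewrite ltry.
apply: (cvge_to_le H); apply: nearW => n.
have Ln : 0 < L / n.+1%:R by rewrite divr_gt0.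
rewrite (_ : integral _ _ _ = (\int[mu]_(x in E_ n) (x `^ p)%:E)%E); last first.
  by apply: eq_integral => x _; rewrite gee0_abs// lee_fin powR_ge0.
(* For n = 0 the segment is the single point L, to which [FTC2_is_derive] does not apply. *)
have [->|n0] := eqVneq n 0%N.
  by rewrite /E_ divr1 set_itv1 integral_set1 lee_fin divr_ge0 ?powR_ge0 ?ltW.
have nL : L / n.+1%:R < L.
  by rewrite ltr_pdivrMr// ltr_pMr// ltr1n ltnS lt0n.
have cf x : L / n.+1%:R <= x <= L -> {for x, continuous (fun x => x `^ p)}.
  move=> /andP[nx _]; apply: (@is_derive_continuous _ _ (p * x `^ (p - 1))).
  by apply: is_derive1_powR; exact: lt_le_trans nx.
have df x : L / n.+1%:R <= x <= L ->
    is_derive x 1 (fun x => (p + 1)^-1 * x `^ (p + 1)) (x `^ p).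
  move=> /andP[nx _]; have x0 := lt_le_trans Ln nx.
  have := is_derive1_powR (p + 1) x0; rewrite addrK => dp.
  have -> : x `^ p = (p + 1)^-1 *: ((p + 1) * x `^ p).
    by rewrite /GRing.scale/= mulrA mulVf ?mul1r// gt_eqF.
  exact: (@is_deriveZ _ _ _ (fun x => x `^ (p + 1))).
rewrite (FTC2_is_derive nL cf df).
by rewrite lee_fin mulrC lerBlDr lerDl mulr_ge0 ?powR_ge0// invr_ge0 ltW.
Qed.

(** The first-order Taylor remainder is at most h^2, whatever the signs of x and x + h. The squared
    positive part is the C^1 building block whose second differences give the test functions
    below. *)
Lemma is_derive_sqr_pos (x : R) :
  is_derive x 1 (fun s : R => (Num.max 0 s) ^+ 2) (2 * Num.max 0 x).
Proof.
suff H : h^-1 *: ((Num.max 0 (h *: (1 : R) + x)) ^+ 2 - (Num.max 0 x) ^+ 2)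
    @[h --> 0^'] --> 2 * Num.max 0 x.
  have H' : cvg (h^-1 *: ((Num.max 0 (h *: (1 : R) + x)) ^+ 2 - (Num.max 0 x) ^+ 2) @[h --> 0^']).
    by apply/cvg_ex; eexists; exact: H.
  by apply: DeriveDef; [exact: H'|exact: cvg_lim].
apply/cvgrPdist_le => e e0; near=> h.
have h0 : h != 0 by near: h; exact: nbhs_dnbhs_neq.
have he : `|h| <= e by near: h; apply: dnbhs0_le.
apply: le_trans he.
have -> : 2 * Num.max 0 x - h^-1 *: (Num.max 0 (h *: (1 : R) + x) ^+ 2 - Num.max 0 x ^+ 2)
  = - (h^-1 * (Num.max 0 (h + x) ^+ 2 - Num.max 0 x ^+ 2 - 2 * Num.max 0 x * h)).
  rewrite /GRing.scale/= mulr1; field.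
  by [].
rewrite normrN normrM normfV ler_pdivrMl ?normr_gt0// -expr2 real_normK ?num_real//.
rewrite ler_norml; apply/andP.
rewrite /Num.max; do 2 case: ltP => ?; split; nra.
Unshelve. all: by end_near. Qed.

(* step c d is a C^1 function with derivative the tent of base [c - d, c + d];
   it increases from 0 to 2 d^2. *)
Definition tent (c d s : R) : R :=
  2 * Num.max 0 (s - (c - d)) - 2 * (2 * Num.max 0 (s - c)) + 2 * Num.max 0 (s - (c + d)).

Definition step (c d s : R) : R :=
  (Num.max 0 (s - (c - d))) ^+ 2 - 2 * (Num.max 0 (s - c)) ^+ 2 +
  (Num.max 0 (s - (c + d))) ^+ 2.

Lemma is_derive_step (c d s : R) : is_derive s 1 (step c d) (tent c d s).
Proof.
have D u : is_derive s 1 (fun s : R => (Num.max 0 (s - u)) ^+ 2) (2 * Num.max 0 (s - u)).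
  have H := is_derive_sqr_pos (s - u).
  have K : is_derive s 1 (fun s : R => s - u) 1.
    by rewrite -[X in is_derive _ _ _ X]subr0; exact: is_deriveB.
  have := @is_derive1_comp R (fun s : R => (Num.max 0 s) ^+ 2) (fun s : R => s - u) s _ _ H K.
  by rewrite mulr1.
have D1 := D (c - d); have D2 := D c; have D3 := D (c + d).
have D2' := @is_deriveZ _ _ _ _ 2 s 1 _ D2.
exact: is_deriveD.
Qed.

Lemma tent_continuous (c d : R) : continuous (tent c d).
Proof.
have D u : continuous (fun s : R => 2 * Num.max 0 (s - u)).
  move=> s; apply: cvgM; first exact: cvg_cst.
  apply: (@continuous_comp _ _ _ (fun s : R => s - u) (fun s : R => Num.max 0 s)).
    by apply: cvgB; [exact: cvg_id|exact: cvg_cst].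
  by apply: continuous_max; [exact: cvg_cst|exact: cvg_id].
move=> s; apply: cvgD; last exact: D.
apply: cvgB; first exact: D.
by apply: cvgM; [exact: cvg_cst|exact: D].
Qed.

Lemma tent_ge0 (c d s : R) : 0 < d -> 0 <= tent c d s.
Proof. by move=> d0; rewrite /tent /Num.max; do 3 case: ltP => ?; lra. Qed.

Lemma tent_eq0 (c d s : R) : 0 < d -> d <= `|s - c| -> tent c d s = 0.
Proof.
move=> d0; rewrite ler_normr => /orP[] ?;
by rewrite /tent /Num.max; do 3 case: ltP => ?; lra.
Qed.

Lemma step_left (c d s : R) : 0 < d -> s <= c - d -> step c d s = 0.
Proof.
by move=> d0 ?; rewrite /step /Num.max; do 3 case: ltP => ?; try lra; ring.
Qed.

Lemma step_right (c d s : R) : 0 < d -> c + d <= s -> step c d s = 2 * d ^+ 2.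
Proof.
move=> d0 ?; rewrite /step /Num.max; do 3 case: ltP => ?; try lra; try ring.
have -> : s = c + d by lra.
ring.
Qed.


End PowersAndTents.

(** * The lemma of du Bois-Reymond *)

Section DuBoisReymond.
Variable R : realType.
Local Notation mu := (@lebesgue_measure R).

Lemma integrable_indicM (D : set R) (f : R -> R) : measurable D ->
  mu.-integrable D (EFin \o f) <->
  mu.-integrable setT (EFin \o (fun x => \1_D x * f x)).
Proof.
move=> mD; rewrite (_ : EFin \o (fun x => \1_D x * f x) = (EFin \o f) \_ D).
  exact: integrable_mkcond.
by apply/funext => x; rewrite patchE /= indicE; case: ifP => _; rewrite ?mul1r ?mul0r.
Qed.

Lemma Rintegral_indicM (D : set R) (f : R -> R) :
  \int[mu]_(x in D) f x = \int[mu]_x (\1_D x * f x).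
Proof.
rewrite Rintegral_mkcond; apply: eq_Rintegral => x _.
by rewrite patchE indicE; case: ifP => _; rewrite ?mul1r ?mul0r.
Qed.

Lemma bounded_on_segment (f : R -> R) (a m : R) :
  (forall t, a <= t <= m -> {for t, continuous f}) ->
  exists M, forall t, a <= t <= m -> `|f t| <= M.
Proof.
move=> cf; have [am|ma] := leP a m; last first.
  by exists 0 => t /andP[a_t t_m]; have := le_trans a_t t_m; rewrite leNgt ma.
have [|c _ H] := @EVT_max R (fun t => `|f t|) a m am.
  apply: continuous_in_subspaceT => x; rewrite inE/= in_itv/= => xam.
  by apply: cvg_norm; exact: cf.
by exists `|f c| => t tam; apply: H; rewrite in_itv.
Qed.

(* If F s1 < F s2, the difference of two narrow tents around s1 and s2 has mean 0
   but pairs negatively with F. *)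
Lemma du_bois_reymond (F : R -> R) (a b : R) :
  mu.-integrable `[a, b] (EFin \o F) ->
  (forall s, a < s < b -> {for s, continuous F}) ->
  (forall h h' : R -> R, (forall s : R, is_derive s 1 h (h' s)) -> continuous h' ->
     h a = 0 -> h b = 0 -> \int[mu]_(s in `[a, b]) (h' s * F s) = 0) ->
  forall s1 s2, a < s1 < b -> a < s2 < b -> F s1 = F s2.
Proof.
move=> iF cF H.
suff lt s1 s2 : a < s1 < b -> a < s2 < b -> F s1 < F s2 -> False.
  move=> s1 s2 s1ab s2ab; apply/eqP; rewrite eq_le !leNgt.
  by apply/andP; split; apply/negP; exact: lt.
move=> s1ab s2ab F12.
(* F(s1) = m - 2e and F(s2) = m + 2e. Where F varies by less than e, it therefore stays below m - e
   around s1 and above m + e around s2. *)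
pose m := (F s1 + F s2) / 2; pose e := (F s2 - F s1) / 4.
have e0 : 0 < e by rewrite /e; lra.
have near_s s : a < s < b -> exists2 d : R, 0 < d &
    [/\ a < s - d, s + d < b & forall x, `|x - s| < d -> `|F x - F s| < e].
  move=> sab; have := cF _ sab => /cvgrPdist_lt /(_ e e0) /nbhs_ballP[d /= d0 Hd].
  exists (Num.min d (Num.min ((s - a) / 2) ((b - s) / 2))).
    by rewrite !lt_min d0; lra.
  have md : Num.min d (Num.min ((s - a) / 2) ((b - s) / 2)) <= d by rewrite ge_min lexx.
  have ma : Num.min d (Num.min ((s - a) / 2) ((b - s) / 2)) <= (s - a) / 2.
    by rewrite !ge_min lexx ?orbT.
  have mb : Num.min d (Num.min ((s - a) / 2) ((b - s) / 2)) <= (b - s) / 2.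
    by rewrite !ge_min lexx ?orbT.
  split; [lra|lra|] => x xs; rewrite distrC; apply: Hd.
  by rewrite /ball/= distrC (lt_le_trans xs).
have [d1 d10 [ad1 d1b F1]] := near_s _ s1ab.
have [d2 d20 [ad2 d2b F2]] := near_s _ s2ab.
pose d := Num.min d1 d2.
have d0 : 0 < d by rewrite lt_min d10.
have dd1 : d <= d1 by rewrite ge_min lexx.
have dd2 : d <= d2 by rewrite ge_min lexx orbT.
pose h s := step s1 d s - step s2 d s.
pose h' s := tent s1 d s - tent s2 d s.
have ab : a < b by lra.
have dh (s : R) : is_derive s 1 h (h' s).
  by apply: is_deriveB; exact: is_derive_step.
have ch' : continuous h'.
  by move=> s; apply: cvgB; exact: tent_continuous.
have ha : h a = 0 by rewrite /h !step_left//; lra.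
have hb : h b = 0 by rewrite /h !step_right//; lra.
have h'F0 := H _ _ dh ch' ha hb.
(* [g] bounds h' F from above: F is replaced by m - e on the first tent and by m + e on the second.
   Its integral is explicit, -4 e d^2, because h vanishes at both ends. *)
pose g s := m * h' s - e * (tent s1 d s + tent s2 d s).
pose G s := m * h s - e * (step s1 d s + step s2 d s).
have cg : continuous g.
  move=> s; apply: cvgB; apply: cvgM; [exact: cvg_cst|exact: ch'|exact: cvg_cst|].
  by apply: cvgD; exact: tent_continuous.
have dG (s : R) : is_derive s 1 G (g s).
  have Z1 := @is_deriveZ _ _ _ _ m s 1 _ (dh s).
  have Z2 := @is_deriveD _ _ _ _ _ s 1 _ _ (is_derive_step s1 d s) (is_derive_step s2 d s).
  have Z3 := @is_deriveZ _ _ _ _ e s 1 _ Z2.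
  exact: (@is_deriveB _ _ _ _ _ s 1 _ _ Z1 Z3).
have intg : \int[mu]_(s in `[a, b]) g s = G b - G a.
  rewrite /Rintegral (FTC2_is_derive ab (fun s _ => cg s) (fun s _ => dG s))//.
have GbGa : G b - G a < 0.
  have -> : G b - G a = - (e * (4 * d ^+ 2)).
    rewrite /G ha hb !(@step_left _ _ _ a)//; [|lra..].
    by rewrite !(@step_right _ _ _ b)//; [ring|lra..].
  by rewrite oppr_lt0 mulr_gt0// mulr_gt0// exprn_gt0.
suff : \int[mu]_(s in `[a, b]) (h' s * F s) <= \int[mu]_(s in `[a, b]) g s.
  by rewrite h'F0 intg leNgt GbGa.
have cint (f : R -> R) : continuous f -> mu.-integrable `[a, b] (EFin \o f).
  move=> cf0; apply: continuous_compact_integrable; first exact: segment_compact.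
  exact: continuous_subspaceT.
have [M h'M] := bounded_on_segment (fun t (_ : a <= t <= b) => ch' t).
apply: le_Rintegral => //.
- apply: (@integrable_boundedM _ `[a, b] h' F M) => //.
  by apply: measurable_funTS; exact: continuous_measurable_fun.
- exact: (cint _ cg).
move=> s _; rewrite /g /h'.
have t1 : tent s1 d s * F s <= tent s1 d s * (m - e).
  have [ds|ds] := leP d `|s - s1|; first by rewrite tent_eq0// !mul0r.
  rewrite ler_wpM2l ?tent_ge0//.
  have := F1 s (lt_le_trans ds dd1); rewrite ltr_norml /m /e => /andP[]; lra.
have t2 : tent s2 d s * (m + e) <= tent s2 d s * F s.
  have [ds|ds] := leP d `|s - s2|; first by rewrite tent_eq0// !mul0r.
  rewrite ler_wpM2l ?tent_ge0//.
  have := F2 s (lt_le_trans ds dd2); rewrite ltr_norml /m /e => /andP[]; lra.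
rewrite mulrBl; lra.
Qed.

Lemma derivative_tail_integral (q : R -> R) (a b t : R) : a <= t < b ->
  mu.-integrable `[a, b] (EFin \o q) ->
  {for t, continuous q} ->
  (fun s => (s - t)^-1 * (\int[mu]_(r in `[s, b]) q r - \int[mu]_(r in `[t, b]) q r))
    @ within `[a, b] t^' --> - q t.
Proof.
move=> /andP[at_ tb] iq cq.
(* Extending q to the left of a by its value at a makes t = a an interior point of [a - 1, b], so
   that the fundamental theorem covers this end point too. *)
pose qh x := q (Num.max a x).
have cqh : {for t, continuous qh}.
  apply: (@continuous_comp _ _ _ (fun x => Num.max a x) q).
    by apply: continuous_max; [exact: cvg_cst|exact: cvg_id].
  by rewrite max_r.
have qhE x : a <= x -> qh x = q x by move=> ax; rewrite /qh max_r.
have iqh : mu.-integrable `[a - 1, b] (EFin \o qh).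
  pose c := q a.
  have mI : measurable (`[a - 1, b]%classic : set (measurableTypeR R)).
    exact: measurable_itv.
  have /(_ (EFin \o (fun x : R => \1_`[a, b] x * q x + \1_`[a - 1, a[ x * c))) :=
    @eq_integrable _ _ R mu _ mI.
  move=> /(_ (EFin \o qh)); apply.
    move=> x; rewrite inE/= in_itv/= => /andP[ax xb].
    rewrite !indicE !mem_setE !in_itv/= xb ax andbT /qh /c.
    by case: (leP a x) => _ /=; rewrite ?(mul1r, mul0r, addr0, add0r).
  apply: (integrableS measurableT) => //.
  have -> : (EFin \o (fun x : R => \1_`[a, b] x * q x + \1_`[a - 1, a[ x * c)) =
    (EFin \o (fun x : R => \1_`[a, b] x * q x)) \+
    (EFin \o (fun x : R => \1_`[a - 1, a[ x * c)) by [].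
  apply: integrableD => //; first exact: (integrable_indicM q (measurable_itv _)).1.
  apply: (integrable_indicM (cst c) (measurable_itv _)).1.
  have ic : mu.-integrable `[a - 1, a] (EFin \o cst c).
    apply: continuous_compact_integrable; first exact: segment_compact.
    by apply: continuous_subspaceT => x; exact: cvg_cst.
  apply: integrableS ic => //.
  by move=> x /=; rewrite !in_itv/= => /andP[-> /ltW].
pose F x := \int[mu]_(r in `[a - 1, x]) qh r.
have [dF F't] : derivable F t 1 /\ derive1 F t = qh t.
  by apply: (continuous_FTC1_closed tb iqh _ cqh); lra.
have FE s : a <= s <= b -> \int[mu]_(r in `[s, b]) q r = F b - F s.
  move=> /andP[a_s sb]; rewrite /F (Rintegral_itvB iqh) ?bnd_simp//; last by lra.
  rewrite Rintegral_itv_obnd_cbnd; last first.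
    apply: integrableS iqh => //.
    by move=> x /=; rewrite !in_itv/= => /andP[sx ->]; rewrite andbT; lra.
  apply: eq_Rintegral => x; rewrite inE/= in_itv/= => /andP[sx _].
  by rewrite qhE// (le_trans a_s).
have {}dF : h^-1 *: (F (h *: (1 : R) + t) - F t) @[h --> 0^'] --> qh t.
  by rewrite -F't derive1E; exact: dF.
apply/cvgrPdist_lt => e e0.
move/cvgrPdist_lt : dF => /(_ e e0) /nbhs_ballP[d /= d0 Hd].
rewrite !near_withinE; apply/nbhs_ballP; exists d => //= s ts st sab.
have st0 : s - t != 0 by rewrite subr_eq0.
have := Hd (s - t).
rewrite /ball/= sub0r normrN distrC => /(_ ts st0).
rewrite {1}/GRing.scale/= /GRing.scale/= mulr1 subrK qhE//.
rewrite (FE s); last by move: sab; rewrite in_itv.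
rewrite (FE t); last by rewrite at_ ltW.
rewrite (_ : - q t - _ = - (q t - (s - t)^-1 * (F s - F t))) ?normrN//.
by ring.
Qed.

End DuBoisReymond.

(** * The Euler-Lagrange equation with memory *)

Section EulerLagrangeScalar.
Variable R : realType.
Local Notation mu := (@lebesgue_measure R).

Lemma integrableM_bounded_on (a b : R) (w P : R -> R) :
  mu.-integrable `[a, b] (EFin \o w) -> continuous P ->
  mu.-integrable `[a, b] (EFin \o (fun t => w t * P t)).
Proof.
move=> iw cP; have [M PM] := bounded_on_segment (fun (t : R) (_ : a <= t <= b) => cP t).
rewrite (_ : EFin \o _ = EFin \o (fun t : R => P t * w t)).
  apply: (@integrable_boundedM _ `[a, b] P w M) => //.
  by apply: measurable_funTS; exact: continuous_measurable_fun.
by apply/funext => t /=; rewrite mulrC.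
Qed.

(** Since h(a) = 0, h is itself the convolution of h' with the indicator [J] of [0, b - a]. The
    terms in h and in h' thus have the same shape, with kernels [J] and [K], and the same exchange
    and continuity lemmas serve both. *)
Lemma euler_lagrange_of_first_variation (a b : R) (K w P1 P2 : R -> R) (N : set R) :
  a < b ->
  mu.-integrable setT (EFin \o K) ->
  (forall r : R, r <= 0 -> K r = 0) ->
  finite_set N -> (forall r, ~ N r -> {for r, continuous K}) ->
  (forall d : R, 0 < d -> exists B : R, forall r : R, d <= r -> `|K r| <= B) ->
  mu.-integrable `[a, b] (EFin \o w) ->
  (forall t : R, a <= t < b -> {for t, continuous w}) ->
  continuous P1 -> continuous P2 ->
  (forall h h' : R -> R, (forall s : R, is_derive s 1 h (h' s)) -> continuous h' ->
     h a = 0 -> h b = 0 ->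
     \int[mu]_(t in `[a, b])
       (w t * (P1 t * h t + P2 t * \int[mu]_(s in `[a, t]) (K (t - s) * h' s))) = 0) ->
  forall t, a <= t < b ->
  (fun s => (s - t)^-1 *
     (\int[mu]_(r in `[s, b]) (K (r - s) * (w r * P2 r)) -
      \int[mu]_(r in `[t, b]) (K (r - t) * (w r * P2 r))))
    @ within `[a, b] t^' --> w t * P1 t.
Proof.
move=> ab iK K0 fN cK KB iw cw cP1 cP2 H.
pose L := b - a.
pose I := \1_`[a, b] : R -> R.
pose p (t : R) := I t * (w t * P2 t).
pose q (t : R) := I t * (w t * P1 t).
pose J := \1_`[0, L] : R -> R.
have IE (t : R) : I t = ((a <= t <= b)%R%:R : R).
  by rewrite /I indicE mem_setE in_itv.
have JE (t : R) : J t = ((0 <= t <= L)%R%:R : R).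
  by rewrite /J indicE mem_setE in_itv.
have iwP (P : R -> R) : continuous P -> mu.-integrable setT (EFin \o (fun t => I t * (w t * P t))).
  move=> cP; apply: (integrable_indicM (fun t => w t * P t) (measurable_itv _)).1.
  exact: integrableM_bounded_on.
have ip : mu.-integrable setT (EFin \o p) by exact: iwP.
have iq : mu.-integrable setT (EFin \o q) by exact: iwP.
have iJ : mu.-integrable setT (EFin \o J).
  by apply: (integrable_indic_itv).
have cwP (P : R -> R) (t : R) : continuous P -> t < b -> ~ [set a] t ->
    {for t, continuous (fun t => I t * (w t * P t))}.
  move=> cP tb /eqP ta.
  have [lta|gta] := ltP t a.
    have : \forall x \near t, cst 0 x = I x * (w x * P x).
      near=> x; rewrite IE leNgt.
      have -> : x < a by near: x; exact: lt_nbhsl.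
      by rewrite /= mul0r.
    by move=> /near_eq_continuous; apply; exact: cvg_cst.
  have {}gta : a < t by rewrite lt_neqAle eq_sym ta.
  have : \forall x \near t, w x * P x = I x * (w x * P x).
    near=> x; rewrite IE.
    have -> : a <= x by apply: ltW; near: x; exact: lt_nbhsr.
    have -> : x <= b by apply: ltW; near: x; exact: lt_nbhsl.
    by rewrite /= mul1r.
  move=> /near_eq_continuous; apply; apply: cvgM; last exact: cP.
  by apply: cw; rewrite ltW.
have bwP (P : R -> R) (m : R) : continuous P -> m < b ->
    exists M : R, forall t : R, t < m -> `|I t * (w t * P t)| <= M.
  move=> cP mb.
  have [M HM] : exists M : R, forall t : R, a <= t <= m -> `|w t * P t| <= M.
    apply: bounded_on_segment => t /andP[a_t tm].
    apply: cvgM; last exact: cP.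
    by apply: cw; rewrite a_t (le_lt_trans tm).
  exists `|M| => t tm; rewrite IE.
  have [at_|ta] := leP a t; last by rewrite /= mul0r normr0.
  rewrite /= (ltW (lt_trans tm mb)) mul1r (le_trans (HM t _)) ?ler_norm//.
  by rewrite at_ ltW.
have cross_cont (k P : R -> R) (N' : set R) : mu.-integrable setT (EFin \o k) -> finite_set N' ->
    (forall r, ~ N' r -> {for r, continuous k}) ->
    (forall d : R, 0 < d -> exists B : R, forall r : R, d <= r -> `|k r| <= B) ->
    continuous P -> forall s, s < b ->
    {for s, continuous (fun s : R => \int[mu]_t (k (t - s) * (I t * (w t * P t))))}.
  move=> ik fN' ck kB cP s sb.
  (* m separates s from the singularity of w at b, and m - d = s + (b - s) / 4 leaves s below m - d,
     as [continuous_cross_singular] requires. *)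
  pose m := (s + b) / 2; pose d := (b - s) / 4.
  have d0 : 0 < d by rewrite /d; lra.
  have mb : m < b by rewrite /m; lra.
  have [B HB] := kB d d0; have [M HM] := bwP P m cP mb.
  apply: (@continuous_cross_singular R k _ d m M B (N' `|` [set a]) d0 ik).
  - exact: iwP.
  - by rewrite finite_setU.
  - exact: HB.
  - by move=> r /not_orP[Nr _]; exact: ck.
  - exact: HM.
  - by move=> t /not_orP[_ ta] tm; apply: cwP => //; exact: lt_trans mb.
  - by rewrite /m /d; lra.
have cJ (r : R) : ~ [set 0; L] r -> {for r, continuous J}.
  move=> /not_orP[/eqP r0 /eqP rL].
  have [rlt0|] := ltP r 0.
    have : \forall x \near r, cst 0 x = J x.
      near=> x; rewrite JE leNgt.
      by have -> : x < 0 by near: x; exact: lt_nbhsl.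
    by move=> /near_eq_continuous; apply; exact: cvg_cst.
  rewrite le_eqVlt eq_sym (negbTE r0)/= => {}r0.
  have [rltL|] := ltP r L.
    have : \forall x \near r, cst 1 x = J x.
      near=> x; rewrite JE.
      have -> : 0 <= x by apply: ltW; near: x; exact: lt_nbhsr.
      by have -> : x <= L by apply: ltW; near: x; exact: lt_nbhsl.
    by move=> /near_eq_continuous; apply; exact: cvg_cst.
  rewrite le_eqVlt eq_sym (negbTE rL)/= => {}rL.
  have : \forall x \near r, cst 0 x = J x.
    near=> x; rewrite JE andbC leNgt.
    by have -> : L < x by near: x; exact: lt_nbhsr.
  by move=> /near_eq_continuous; apply; exact: cvg_cst.
have JB (d : R) : 0 < d -> exists B : R, forall r : R, d <= r -> `|J r| <= B.
  move=> _; exists 1 => r _; rewrite JE; case: (_ && _); rewrite /= ?normr1 ?normr0//.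
have f0L : finite_set [set 0; L] by rewrite finite_setU; split.
pose FP (s : R) := \int[mu]_t (K (t - s) * p t).
pose FQ (s : R) := \int[mu]_t (J (t - s) * q t).
have cFP (s : R) : s < b -> {for s, continuous FP} by exact: (cross_cont K P2 N).
have cFQ (s : R) : s < b -> {for s, continuous FQ} by exact: (cross_cont J P1 [set 0; L]).
have m1 : measurable_fun setT (cst 1 : R -> R) by exact: measurable_cst.
have norm1 (x : R) : `|cst 1 x : R| <= 1 by rewrite normr1.
(* The exchange lemma with the test function 1 contains this integrability. *)
have iFP : mu.-integrable setT (EFin \o FP).
  have [+ _ _] := @Rintegral_cross_exchange R K p (cst 1) 1 iK ip m1 norm1.
  by congr (_.-integrable _ _); apply/funext => s /=; rewrite mul1r.
have iFQ : mu.-integrable setT (EFin \o FQ).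
  have [+ _ _] := @Rintegral_cross_exchange R J q (cst 1) 1 iJ iq m1 norm1.
  by congr (_.-integrable _ _); apply/funext => s /=; rewrite mul1r.
have FPE (s : R) : a <= s -> FP s = \int[mu]_(r in `[s, b]) (K (r - s) * (w r * P2 r)).
  move=> as_; rewrite [RHS]Rintegral_indicM; apply: eq_Rintegral => r _.
  rewrite /p IE indicE mem_setE in_itv/=.
  have [sr|rs] := leP s r; last first.
    have rs0 : r - s <= 0 by rewrite subr_le0 ltW.
    by rewrite (K0 _ rs0) !mul0r.
  by rewrite (le_trans as_ sr) mulrCA.
have FQE (s : R) : a <= s -> FQ s = \int[mu]_(r in `[s, b]) (w r * P1 r).
  move=> as_; rewrite [RHS]Rintegral_indicM; apply: eq_Rintegral => r _.
  rewrite /q JE IE indicE mem_setE in_itv/= subr_ge0.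
  have [sr|rs] := leP s r; last by rewrite /= !mul0r.
  rewrite (le_trans as_ sr)/=; have [rb|_] := leP r b; last by rewrite !mul0r mulr0.
  by rewrite lerB// !mul1r.
have F0 (h h' : R -> R) : (forall s : R, is_derive s 1 h (h' s)) -> continuous h' ->
    h a = 0 -> h b = 0 -> \int[mu]_(s in `[a, b]) (h' s * (FP s + FQ s)) = 0.
  move=> dh ch' ha hb; rewrite -(H h h' dh ch' ha hb).
  pose phi (s : R) := I s * h' s.
  have mphi : measurable_fun setT phi.
    apply: measurable_funM; first exact: measurable_indic.
    exact: continuous_measurable_fun.
  have [M h'M] := bounded_on_segment (fun (t : R) (_ : a <= t <= b) => ch' t).
  have phiM s : `|phi s| <= `|M|.
    rewrite /phi IE; have [sab|_] := boolP (a <= s <= b); last by rewrite /= mul0r normr0.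
    by rewrite /= mul1r (le_trans (h'M _ sab))// ler_norm.
  have [iKP iKP' EP] := @Rintegral_cross_exchange R K p phi `|M| iK ip mphi phiM.
  have [iJQ iJQ' EQ] := @Rintegral_cross_exchange R J q phi `|M| iJ iq mphi phiM.
  transitivity (\int[mu]_s (phi s * FP s) + \int[mu]_s (phi s * FQ s)).
    rewrite Rintegral_indicM -RintegralD//.
    by apply: eq_Rintegral => s _; rewrite -/I /phi; ring.
  rewrite -EP -EQ -RintegralD// [RHS]Rintegral_indicM.
  apply: eq_Rintegral => t _; rewrite /p /q -/I IE.
  have [/andP[at_ tb]|_] := boolP (a <= t <= b); last by rewrite /= !mul0r addr0.
  rewrite /= !mul1r.
  have -> : \int[mu]_s (K (t - s) * phi s) = \int[mu]_(s in `[a, t]) (K (t - s) * h' s).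
    rewrite [RHS]Rintegral_indicM; apply: eq_Rintegral => s _.
    rewrite /phi IE indicE mem_setE in_itv/=.
    have [sa|as_] := ltP s a; first by rewrite /= !mul0r mulr0.
    have [st|ts] := leP s t; first by rewrite (le_trans st tb)/= !mul1r.
    have ts0 : t - s <= 0 by rewrite subr_le0 ltW.
    by rewrite (K0 _ ts0) !mul0r.
  have -> : \int[mu]_s (J (t - s) * phi s) = \int[mu]_(s in `[a, t]) h' s.
    rewrite [RHS]Rintegral_indicM; apply: eq_Rintegral => s _.
    rewrite /phi IE JE indicE mem_setE in_itv/= subr_ge0.
    have [sa|as_] := ltP s a; first by rewrite /= !mul0r mulr0.
    have [st|ts] := leP s t; last by rewrite /= !mul0r.
    by rewrite (le_trans st tb)/= lerB// !mul1r.
  have -> : \int[mu]_(s in `[a, t]) h' s = h t.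
    move: at_; rewrite le_eqVlt => /predU1P[<-|at_].
      by rewrite set_itv1 Rintegral_set1 ha.
    rewrite /Rintegral (FTC2_is_derive at_ (fun s _ => ch' s) (fun s _ => dh s))/=.
    by rewrite ha subr0.
  by rewrite mulrDr addrC !mulrA.
pose F s := FP s + FQ s.
have cF (s : R) : s < b -> {for s, continuous F}.
  by move=> sb; apply: cvgD; [exact: cFP|exact: cFQ].
have iF : mu.-integrable `[a, b] (EFin \o F).
  apply: (@integrableS _ _ R mu setT) => //.
  exact: (integrableD measurableT iFP iFQ).
pose c := F ((a + b) / 2).
have Fc (s : R) : a < s < b -> F s = c.
  move=> sab; apply: (du_bois_reymond iF _ F0 sab); last by apply/andP; split; lra.
  by move=> r /andP[_ rb]; exact: cF.
(* Du Bois-Reymond speaks of the open interval only. As [FP] and [FQ] are defined on the whole line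
   and continuous at every s < b, the constant value extends to a. *)
have Fa : F a = c.
  have H1 : F x @[x --> a^'+] --> F a.
    by apply: cvg_at_right_filter; exact: cF.
  have H2 : F x @[x --> a^'+] --> c.
    apply: (@cvg_trans _ (cst c x @[x --> a^'+])); last exact: cvg_cst.
    apply: near_eq_cvg; near=> x; rewrite /= Fc//.
    apply/andP; split; first by near: x; exact: nbhs_right_gt.
    by near: x; exact: nbhs_right_lt.
  exact: (cvg_unique _ H1 H2).
have FPc (s : R) : a <= s < b -> FP s = c - FQ s.
  move=> /andP[as_ sb]; have -> : c = F s.
    by move: as_; rewrite le_eqVlt => /predU1P[<-//|as_]; rewrite Fc// as_.
  by rewrite /F addrK.
move=> t /andP[at_ tb].
have ct : {for t, continuous (fun t => w t * P1 t)}.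
  by apply: cvgM; [apply: cw; rewrite at_|exact: cP1].
have tab : a <= t < b by rewrite at_.
have := derivative_tail_integral tab (integrableM_bounded_on iw cP1) ct.
(* For s close to t one has s < b, so [FP] is c - [FQ] at s and at t: the constant cancels in the
   quotient and the derivative of the tail integral changes sign. *)
move=> /cvgN; rewrite opprK; apply: cvg_trans; apply: near_eq_cvg.
rewrite !near_withinE; near=> s => st; rewrite /= in_itv/= => /andP[as_ _].
have sb : s < b by near: s; exact: lt_nbhsl.
rewrite !fctE -(FPE s as_) -(FPE t at_) -(FQE s as_) -(FQE t at_).
rewrite !FPc ?as_ ?at_//. ring.
Unshelve. all: by end_near. Qed.

End EulerLagrangeScalar.

(** * First variation of a weighted integral *)

Section FirstVariation.
Variable R : realType.
Local Notation mu := (@lebesgue_measure R).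

Lemma MVT_from0 (f f' : R -> R) (y : R) : (forall s : R, is_derive s 1 f (f' s)) ->
  exists2 c, `|c| <= `|y| & f y - f 0 = f' c * y.
Proof.
move=> df; have cf s : {for s, continuous f} by exact: is_derive_continuous.
have [y0|y0|<-] := ltgtP 0 y.
- have [|c] := @MVT R f f' 0 y y0 (fun s _ => df s).
    by apply: continuous_in_subspaceT => s _; exact: cf.
  rewrite in_itv/= subr0 => /andP[c0 cy] E; exists c => //.
  by rewrite !gtr0_norm// ltW.
- have [|c] := @MVT R f f' y 0 y0 (fun s _ => df s).
    by apply: continuous_in_subspaceT => s _; exact: cf.
  rewrite in_itv/= => /andP[yc c0] E; exists c.
    by rewrite !ltr0_norm// lerN2 ltW.
  by rewrite -[LHS]opprB E; ring.
- by exists 0; rewrite ?normr0// subrr mulr0.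
Qed.

Lemma bounded_on_box (f : R * R * R -> R) (a b A B : R) : continuous f ->
  exists M, forall t al be : R, a <= t <= b -> `|al| <= A -> `|be| <= B ->
    `|f (t, al, be)| <= M.
Proof.
move=> cf.
pose D : set (R * R * R) := (`[a, b] `*` `[- A, A]) `*` `[- B, B].
have cD : compact D by do !apply: compact_setX; exact: segment_compact.
have : compact (f @` D).
  by apply: continuous_compact => //; exact: continuous_subspaceT.
move=> /compact_bounded [M [_ HM]]; exists (M + 1) => t al be tab alA beB.
apply: (HM (M + 1)); first by rewrite ltrDl.
by exists (t, al, be) => //; rewrite /D /= !in_itv/= tab -!ler_norml.
Qed.

Lemma continuous_curve (f : R * R * R -> R) (h z : R -> R) : continuous f ->
  continuous h -> continuous z -> continuous (fun t => f (t, h t, z t)).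
Proof.
move=> cf ch cz t; apply: (@continuous_comp _ _ _ (fun t => (t, h t, z t)) f); last exact: cf.
have c1 : {for t, continuous (fun t => (t, h t))} by exact: (cvg_pair cvg_id (ch t)).
exact: (cvg_pair c1 (cz t)).
Qed.

(** [Phi] is the Lagrangian along a perturbed curve, al and be being the shifts of the i-th
    components of x and u. Continuous partial derivatives in al and be suffice, which fits [PC1], a
    condition on directional derivatives. *)
Lemma first_variation (a b : R) (w h z : R -> R) (Phi Phi1 Phi2 : R * R * R -> R) :
  mu.-integrable `[a, b] (EFin \o w) ->
  continuous Phi -> continuous Phi1 -> continuous Phi2 ->
  (forall t al be : R, a <= t <= b ->
     is_derive al 1 (fun al => Phi (t, al, be)) (Phi1 (t, al, be))) ->
  (forall t al be : R, a <= t <= b ->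
     is_derive be 1 (fun be => Phi (t, al, be)) (Phi2 (t, al, be))) ->
  continuous h -> continuous z ->
  (forall e : R, \int[mu]_(t in `[a, b]) (w t * Phi (t, e * h t, e * z t)) <=
     \int[mu]_(t in `[a, b]) (w t * Phi (t, 0, 0))) ->
  \int[mu]_(t in `[a, b]) (w t * (Phi1 (t, 0, 0) * h t + Phi2 (t, 0, 0) * z t)) = 0.
Proof.
move=> iw cPhi cPhi1 cPhi2 d1 d2.
have c0 : continuous (fun _ : R => 0 : R) by move=> t; exact: cvg_cst.
have cv (h' z' : R -> R) : continuous h' -> continuous z' ->
    continuous (fun t => Phi1 (t, 0, 0) * h' t + Phi2 (t, 0, 0) * z' t).
  move=> ch cz t; apply: cvgD; (apply: cvgM; last by [exact: ch|exact: cz]).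
  - exact: (continuous_curve cPhi1 c0 c0).
  - exact: (continuous_curve cPhi2 c0 c0).
(* One inequality is enough: changing the sign of the perturbation gives the other, as e ranges over
   all reals. *)
suff H (h' z' : R -> R) : continuous h' -> continuous z' ->
  (forall e : R, \int[mu]_(t in `[a, b]) (w t * Phi (t, e * h' t, e * z' t)) <=
     \int[mu]_(t in `[a, b]) (w t * Phi (t, 0, 0))) ->
  \int[mu]_(t in `[a, b]) (w t * (Phi1 (t, 0, 0) * h' t + Phi2 (t, 0, 0) * z' t)) <= 0.
  move=> ch cz J; apply/eqP; rewrite eq_le H//=.
  rewrite -oppr_le0 -mulN1r -RintegralZl//; last first.
    by apply: integrableM_bounded_on => //; exact: cv.
  rewrite (_ : \int[mu]_(x in _) _ = \int[mu]_(t in `[a, b])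
     (w t * (Phi1 (t, 0, 0) * (- h t) + Phi2 (t, 0, 0) * (- z t)))); last first.
    by apply: eq_Rintegral => t _; ring.
  apply: (H (fun t => - h t) (fun t => - z t)).
  - by move=> t; apply: cvgN; exact: ch.
  - by move=> t; apply: cvgN; exact: cz.
  - move=> e; rewrite (_ : \int[mu]_(x in _) _ = \int[mu]_(t in `[a, b])
      (w t * Phi (t, (- e) * h t, (- e) * z t))); first exact: J.
    by apply: eq_Rintegral => t _; rewrite !mulrN !mulNr.
move=> {}ch {}cz J {h z}.
rename h' into h; rename z' into z.
have [A hA] := bounded_on_segment (fun (t : R) (_ : a <= t <= b) => ch t).
have [B zB] := bounded_on_segment (fun (t : R) (_ : a <= t <= b) => cz t).
have [M1 P1M] := bounded_on_box a b A B cPhi1.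
have [M2 P2M] := bounded_on_box a b A B cPhi2.
pose e n : R := n.+1%:R^-1.
have e0 n : 0 < e n by rewrite invr_gt0.
have e1 n : e n <= 1 by rewrite invf_le1// ler1n.
pose D n t := w t * ((e n)^-1 * (Phi (t, e n * h t, e n * z t) - Phi (t, 0, 0))).
(* The increment is split into a move in al with be at its final value, followed by a move in be
   with al = 0, and each gets its own mean value point. *)
have mean n t : a <= t <= b -> exists th th' : R,
    [/\ `|th| <= `|e n * h t|, `|th'| <= `|e n * z t| &
    (e n)^-1 * (Phi (t, e n * h t, e n * z t) - Phi (t, 0, 0)) =
      Phi1 (t, th, e n * z t) * h t + Phi2 (t, 0, th') * z t].
  move=> tab.
  have [th thh E1] := @MVT_from0 (fun al => Phi (t, al, e n * z t))
    (fun al => Phi1 (t, al, e n * z t)) (e n * h t) (fun al => d1 t al _ tab).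
  have [th' thz E2] := @MVT_from0 (fun be => Phi (t, 0, be))
    (fun be => Phi2 (t, 0, be)) (e n * z t) (fun be => d2 t 0 be tab).
  exists th, th'; split => //.
  have -> : Phi (t, e n * h t, e n * z t) - Phi (t, 0, 0) =
    Phi1 (t, th, e n * z t) * (e n * h t) + Phi2 (t, 0, th') * (e n * z t).
    by rewrite -E1 -E2; ring.
  by field; rewrite gt_eqF.
have eh n (y Y : R) : `|y| <= Y -> `|e n * y| <= Y.
  move=> yY; rewrite normrM gtr0_norm// (le_trans _ yY)//.
  by rewrite ler_piMl.
have cD n : continuous (fun t => (e n)^-1 * (Phi (t, e n * h t, e n * z t) - Phi (t, 0, 0))).
  move=> t; apply: cvgM; first exact: cvg_cst.
  apply: cvgB; last exact: (continuous_curve cPhi c0 c0).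
  apply: (continuous_curve cPhi) => s; apply: cvgM; try exact: cvg_cst.
    exact: ch.
  exact: cz.
have mw : measurable_fun (`[a, b]%classic : set R) w.
  by apply/measurable_EFinP; exact: measurable_int iw.
have mD n : measurable_fun (`[a, b]%classic : set R) (D n).
  apply: measurable_funM => //; apply: measurable_funTS.
  exact: continuous_measurable_fun (cD n).
have intD n : \int[mu]_(t in `[a, b]) D n t <= 0.
  rewrite (_ : \int[mu]_(t in _) _ = (e n)^-1 *
    (\int[mu]_(t in `[a, b]) (w t * Phi (t, e n * h t, e n * z t)) -
     \int[mu]_(t in `[a, b]) (w t * Phi (t, 0, 0)))).
    by rewrite pmulr_rle0 ?invr_gt0// subr_le0; exact: J.
  rewrite -RintegralB//.
  - rewrite -RintegralZl//.
      by apply: eq_Rintegral => t _; rewrite /D; ring.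
    rewrite (_ : EFin \o _ =
      EFin \o (fun t => w t * (Phi (t, e n * h t, e n * z t) - Phi (t, 0, 0)))).
      apply: integrableM_bounded_on => // t.
      apply: cvgB; last exact: (continuous_curve cPhi c0 c0).
      apply: (continuous_curve cPhi) => s; apply: cvgM; try exact: cvg_cst.
        exact: ch.
      exact: cz.
    by apply/funext => t /=; congr (_%:E); ring.
  - apply: integrableM_bounded_on => //.
    apply: (continuous_curve cPhi) => s; apply: cvgM; try exact: cvg_cst.
      exact: ch.
    exact: cz.
  - by apply: integrableM_bounded_on => //; exact: (continuous_curve cPhi c0 c0).
have e_cvg : e n @[n --> \oo] --> 0 by exact: cvg_harmonic.
suff lim : \int[mu]_(t in `[a, b]) D n t @[n --> \oo] -->
    \int[mu]_(t in `[a, b]) (w t * (Phi1 (t, 0, 0) * h t + Phi2 (t, 0, 0) * z t)).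
  by apply: (cvgr_to_le lim); apply: nearW => n; exact: intD.
apply: (@Rintegral_dct _ `[a, b]%classic D _
  (fun t => (`|M1| * `|A| + `|M2| * `|B|) * `|w t|)) => //.
- apply: measurable_funM => //; apply: measurable_funTS.
  by apply: continuous_measurable_fun; exact: cv.
- apply: aeW => t; rewrite /= in_itv/= => tab.
  apply: cvgM; first exact: cvg_cst.
  apply/cvgrPdist_lt => eps eps0.
  (* The two errors add up to at most eta (|h t| + |z t|), hence to at most eps / 2; the summand 1
     keeps the denominator positive. *)
  pose eta := eps / 2 / (1 + `|h t| + `|z t|).
  have S0 : 0 < 1 + `|h t| + `|z t| by rewrite -addrA ltr_wpDr// addr_ge0.
  have eta0 : 0 < eta by rewrite !divr_gt0.
  have /cvgrPdist_lt /(_ _ eta0) /nbhs_ballP[r1 /= r10 H1] := cPhi1 (t, 0, 0).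
  have /cvgrPdist_lt /(_ _ eta0) /nbhs_ballP[r2 /= r20 H2] := cPhi2 (t, 0, 0).
  have hz : \forall n \near \oo, `|e n * h t| < r1 /\ `|e n * z t| < Num.min r1 r2.
    have c1 : e n * h t @[n --> \oo] --> 0 * h t by apply: cvgM => //; exact: cvg_cst.
    have c2 : e n * z t @[n --> \oo] --> 0 * z t by apply: cvgM => //; exact: cvg_cst.
    rewrite !mul0r in c1 c2.
    near=> n; split.
      by near: n; have /cvgr0Pnorm_lt := c1; apply.
    near: n; have /cvgr0Pnorm_lt := c2; apply; by rewrite lt_min r10.
  near=> n.
  have [/= hn] : `|e n * h t| < r1 /\ `|e n * z t| < Num.min r1 r2 by near: n.
  rewrite lt_min => /andP[zn1 zn2].
  have [th [th' [thh thz ->]]] := mean n t tab.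
  have K1 : `|Phi1 (t, 0, 0) - Phi1 (t, th, e n * z t)| < eta.
    apply: H1; split; [split|] => /=; rewrite /ball/=.
    - by rewrite subrr normr0.
    - by rewrite sub0r normrN (le_lt_trans thh).
    - by rewrite sub0r normrN.
  have K2 : `|Phi2 (t, 0, 0) - Phi2 (t, 0, th')| < eta.
    apply: H2; split; [split|] => /=; rewrite /ball/=.
    - by rewrite subrr normr0.
    - by rewrite subrr normr0.
    - by rewrite sub0r normrN (le_lt_trans thz).
  rewrite opprD addrACA -!mulrBl (le_lt_trans (ler_normD _ _))// !normrM.
  apply: (@le_lt_trans _ _ (eta * `|h t| + eta * `|z t|)).
    by apply: lerD; rewrite ler_wpM2r// ltW.
  rewrite -mulrDr (@le_lt_trans _ _ (eta * (1 + `|h t| + `|z t|)))//.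
    by rewrite ler_pM2l// -addrA lerDr.
  by rewrite /eta divfK ?gt_eqF//; lra.
- apply: (@integrable_boundedM R `[a, b]%classic (fun=> `|M1| * `|A| + `|M2| * `|B|)
    (fun t => `|w t|) (`|M1| * `|A| + `|M2| * `|B|)) => //.
    by move=> t _; rewrite ger0_norm// addr_ge0// mulr_ge0.
  exact: integrable_norm.
- move=> n t; rewrite /= in_itv/= => tab; rewrite /D normrM mulrC.
  rewrite ler_wpM2r//.
  have [th [th' [thh thz ->]]] := mean n t tab.
  have nA := hA t tab; have nB := zB t tab.
  rewrite (le_trans (ler_normD _ _))// !normrM lerD// ler_pM//.
  + rewrite (le_trans (P1M _ _ _ tab _ _)) ?ler_norm//.
      by rewrite (le_trans thh)// eh.
    by rewrite eh.
  + by rewrite (le_trans nA)// ler_norm.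
  + rewrite (le_trans (P2M _ _ _ tab _ _)) ?ler_norm// ?normr0.
      by rewrite (le_trans _ nA).
    by rewrite (le_trans thz)// eh.
  + by rewrite (le_trans nB)// ler_norm.
Unshelve. all: by end_near. Qed.

End FirstVariation.

(** * Piecewise continuously differentiable functions *)

Section Slabs.
Variable R : realType.

Lemma is_deriveE (V W : normedModType R) (x v : V) (f : V -> W) (d : W) :
  is_derive x v f d <-> (h^-1 *: (f (h *: v + x) - f x) @[h --> 0^'] --> d).
Proof.
split=> [[df <-]|H]; first exact: df.
have H' : cvg (h^-1 *: (f (h *: v + x) - f x) @[h --> 0^']).
  by apply/cvg_ex; exists d; exact: H.
by apply: DeriveDef; [exact: H'|exact: cvg_lim].
Qed.

Lemma within_continuous_eps (V W : normedModType R) (A : set V) (f : V -> W) (p : V) (e : R) :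
  {within A, continuous f} -> A p -> 0 < e ->
  exists2 d : R, 0 < d & forall q, A q -> `|q - p| < d -> `|f q - f p| < e.
Proof.
move=> /subspace_continuousP cf Ap e0.
have /cvgrPdist_lt /(_ e e0) := cf p Ap.
rewrite near_withinE => /nbhs_normP[d /= d0 H]; exists d => // q Aq qp.
by rewrite distrC; apply: H => //=; rewrite distrC.
Qed.

Lemma is_derive_line (V : normedModType R) (f : V -> R^o) (p v : V) (s d : R) :
  is_derive (p + s *: v) v f d -> is_derive s 1 (fun s : R => f (p + s *: v)) d.
Proof.
move=> /is_deriveE H; apply/is_deriveE.
have -> : (fun h : R => h^-1 *: (f (p + (h *: (1 : R) + s) *: v) - f (p + s *: v))) =
    (fun h : R => h^-1 *: (f (h *: v + (p + s *: v)) - f (p + s *: v))).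
  apply/funext => h; congr (_ *: (f _ - _)).
  by rewrite scalerDl /GRing.scale/= mulr1 addrCA.
exact: H.
Qed.

Section Slab.
Variables (V : normedModType R) (tau : V -> R) (e0 v : V).
Hypothesis tau_e0 : forall p (k : R), tau (p + k *: e0) = tau p + k.
Hypothesis tau_v : forall p (k : R), tau (p + k *: v) = tau p.

(** A line in the direction [v] never leaves its slice of [tau]. A line in a boundary slice is
    therefore a limit of parallel lines in the open slab, and the two-sided derivative along it is
    inherited from them. *)
Lemma is_derive_closed_slab (a b c d : R) (f g : V -> R^o) :
  a <= c -> c < d -> d <= b ->
  {within tau @^-1` `[a, b], continuous f} ->
  {within tau @^-1` `[c, d], continuous g} ->
  (forall p, c < tau p < d -> is_derive p v f (g p)) ->
  forall p, c <= tau p <= d -> is_derive p v f (g p).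
Proof.
move=> ac cd db cf cg fg p /andP[cp pd].
have pcd : (tau @^-1` `[c, d]) p by rewrite /= in_itv/= cp.
have slab q : c <= tau q <= d -> (tau @^-1` `[a, b]) q.
  by move=> /andP[cq qd]; rewrite /= in_itv/= (le_trans ac cq) (le_trans qd db).
(* A positive bound for both norms: with parameters below r / 2 / N, each of the moves along [e0]
   and [v] has length below r / 2. *)
pose N := 1 + `|v| + `|e0|.
have N0 : 0 < N by rewrite /N -addrA ltr_wpDr// addr_ge0.
have vN : `|v| <= N by rewrite /N -addrA addrCA lerDl addr_ge0.
have eN : `|e0| <= N by rewrite /N lerDr addr_ge0.
suff H (e : R) : 0 < e -> exists2 r : R, 0 < r &
    forall h : R, `|h| < r -> `|f (h *: v + p) - f p - h * g p| <= `|h| * e.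
  apply/is_deriveE/cvgrPdist_le => e e0'; have [r r0 Hr] := H e e0'.
  near=> h.
  have h0 : h != 0 by near: h; exact: nbhs_dnbhs_neq.
  have hr : `|h| < r by near: h; apply: dnbhs0_lt.
  rewrite (_ : g p - _ = - (h^-1 * (f (h *: v + p) - f p - h * g p))).
    rewrite normrN normrM normfV ler_pdivrMl ?normr_gt0//; exact: Hr.
  by rewrite /GRing.scale/= [in RHS]mulrBr mulKf// opprB.
move=> ee0.
have [r r0 Hr] := within_continuous_eps cg pcd ee0.
exists (r / 2 / N); first by rewrite !divr_gt0.
move=> h hr.
(* The difference quotient is controlled in the interior by the mean value
   theorem; the bound passes to the boundary by continuity of f. *)
have interior (k : R) : `|k| < r / 2 / N -> c < tau p + k < d ->
    `|f (p + k *: e0 + h *: v) - f (p + k *: e0) - h * g p| <= `|h| * e.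
  move=> kr kcd.
  have dl (s : R) : is_derive s 1 (fun s : R => f (p + k *: e0 + s *: v))
      (g (p + k *: e0 + s *: v)).
    by apply: is_derive_line; apply: fg; rewrite tau_v tau_e0.
  have [th thh E] := MVT_from0 h dl.
  have {}E : f (p + k *: e0 + h *: v) - f (p + k *: e0) = g (p + k *: e0 + th *: v) * h.
    by rewrite -E scale0r addr0.
  rewrite E mulrC -mulrBr normrM ler_wpM2l// ltW//; apply: Hr.
    by rewrite /= in_itv/= tau_v tau_e0; case/andP: kcd => ? ?; rewrite !ltW.
  rewrite (_ : _ - p = k *: e0 + th *: v); last by rewrite -(addrA p) (addrC p) addrK.
  rewrite (le_lt_trans (ler_normD _ _))// !normrZ.
  have : `|k| * `|e0| < r / 2.
    rewrite (le_lt_trans (_ : _ <= `|k| * N)) ?ler_wpM2l//.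
    by rewrite -ltr_pdivlMr.
  have : `|th| * `|v| < r / 2.
    rewrite (le_lt_trans (_ : _ <= `|th| * N)) ?ler_wpM2l//.
    by rewrite -ltr_pdivlMr// (le_lt_trans thh).
  by lra.
apply/ler_addgt0Pr => eps eps0.
have phcd : c <= tau (p + h *: v) <= d by rewrite tau_v cp.
have pcd' : c <= tau p <= d by rewrite cp.
have eps2 : 0 < eps / 2 by lra.
have [r1 r10 H1] := within_continuous_eps cf (slab _ phcd) eps2.
have [r2 r20 H2] := within_continuous_eps cf (slab _ pcd') eps2.
pose r3 := Num.min (r / 2 / N) (Num.min (r1 / N) (r2 / N)).
have r30 : 0 < r3 by rewrite !lt_min !divr_gt0.
(* A short move along [e0] into the open slab: upwards if [tau p < d], downwards if p lies on the
   top slice. *)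
have [k kr3 kcd] : exists2 k : R, `|k| < r3 & c < tau p + k < d.
  have [pltd|dlep] := ltP (tau p) d.
    exists (Num.min (r3 / 2) ((d - tau p) / 2)).
      rewrite ger0_norm; last by rewrite le_min; apply/andP; split; lra.
      by rewrite gt_min; apply/orP; left; lra.
    have : Num.min (r3 / 2) ((d - tau p) / 2) <= (d - tau p) / 2 by rewrite ge_min lexx orbT.
    have : 0 < Num.min (r3 / 2) ((d - tau p) / 2) by rewrite lt_min; apply/andP; split; lra.
    by move=> ? ?; apply/andP; split; lra.
  have pE : tau p = d by apply/eqP; rewrite eq_le pd.
  exists (- Num.min (r3 / 2) ((d - c) / 2)).
    rewrite normrN ger0_norm; last by rewrite le_min; apply/andP; split; lra.
    by rewrite gt_min; apply/orP; left; lra.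
  have : Num.min (r3 / 2) ((d - c) / 2) <= (d - c) / 2 by rewrite ge_min lexx orbT.
  have : 0 < Num.min (r3 / 2) ((d - c) / 2) by rewrite lt_min; apply/andP; split; lra.
  by move=> ? ?; rewrite pE; apply/andP; split; lra.
move: kr3; rewrite !lt_min => /and3P[kr kr1 kr2].
have ke (r' : R) : `|k| < r' / N -> `|k *: e0| < r'.
  rewrite ltr_pdivlMr// => kN; rewrite normrZ (le_lt_trans _ kN)//.
  by rewrite ler_wpM2l.
have I := interior k kr kcd.
have kcd' : c <= tau p + k <= d by case/andP: kcd => ? ?; rewrite !ltW.
have G1 : `|f (p + k *: e0 + h *: v) - f (p + h *: v)| < eps / 2.
  apply: H1; first by apply: slab; rewrite tau_v tau_e0.
  by rewrite (addrAC p) (addrC (p + _)) addrK; exact: ke.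
have G2 : `|f (p + k *: e0) - f p| < eps / 2.
  apply: H2; first by apply: slab; rewrite tau_e0.
  by rewrite (addrC p) addrK; exact: ke.
move: I G1 G2; rewrite [h *: v + p]addrC.
rewrite !ler_norml !ltr_norml => /andP[? ?] /andP[? ?] /andP[? ?].
by apply/andP; split; lra.
Unshelve. all: by end_near. Qed.

Lemma closed_slab (c d : R) : continuous tau -> closed (tau @^-1` `[c, d]).
Proof.
move=> ct; apply: preimage_closed => //; exact: interval_closed.
Qed.

Lemma within_continuous_partition (W : topologicalType) (f : V -> W) (a b : R) (s : seq R) :
  continuous tau -> itv_partition a b s -> a < b ->
  (forall i, (i < size s)%N ->
     {within tau @^-1` `[nth b (a :: s) i, nth b s i], continuous f}) ->
  {within tau @^-1` `[a, b], continuous f}.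
Proof.
move=> ct; elim: s a => [|x s IH] a [pas /eqP lb] ab H.
  by move: ab; rewrite -lb ltxx.
have [ax pxs] := andP pas.
have H0 := H 0%N isT; move: H0 => /= H0.
have [sn|sn] := eqVneq s [::].
  by move: lb; rewrite sn /= => xb; move: H0; rewrite xb.
have xb : x < b.
  case: s sn pxs lb {IH H pas} => // y s _ /= /andP[xy].
  move=> /(order_path_min lt_trans) /allP ys <-.
  by have := mem_last y s; rewrite inE => /predU1P[->//|/ys]; exact: lt_trans.
have pE : tau @^-1` `[a, b] = tau @^-1` `[a, x] `|` tau @^-1` `[x, b].
  apply/seteqP; split => p /=; rewrite !in_itv/=.
    by move=> /andP[ap pb]; have [px|xp] := leP (tau p) x; [left|right]; rewrite ?ap ?pb ?ltW.
  by move=> [/andP[ap px]|/andP[xp pb]]; apply/andP; split; lra.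
rewrite pE; apply: withinU_continuous => //; try exact: closed_slab.
apply: IH => //; first by split => //; apply/eqP.
by move=> i is_; exact: (H i.+1).
Qed.

Lemma partition_bounds (a b : R) (s : seq R) (i : nat) : itv_partition a b s ->
  (i < size s)%N ->
  [/\ a <= nth b (a :: s) i, nth b (a :: s) i < nth b s i & nth b s i <= b].
Proof.
elim: s a i => [//|x s IH] a i [pas /eqP lb] is_.
have [ax pxs] := andP pas.
have pp : itv_partition x b s by split => //; apply/eqP.
case: i is_ => [_|i is_] /=.
  split => //.
  case: s IH pas lb pxs pp => [/=|y s IH _ _ _ pp]; first by move=> _ _ ->.
  by have [_ _] := IH x 0%N pp isT; apply: le_trans; apply/ltW; case: pp => /andP[].
have [xi ii ib] := IH x i pp is_.
by split => //; rewrite (le_trans (ltW ax)).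
Qed.

Lemma partition_cover (a b : R) (s : seq R) (t : R) : itv_partition a b s ->
  a < b -> a <= t <= b ->
  exists2 i, (i < size s)%N & nth b (a :: s) i <= t <= nth b s i.
Proof.
elim: s a => [|x s IH] a [pas /eqP lb] ab /andP[at_ tb].
  by move: ab; rewrite -lb ltxx.
have [ax pxs] := andP pas.
have pp : itv_partition x b s by split => //; apply/eqP.
have [tx|xt] := leP t x; first by exists 0%N => //=; rewrite at_.
have [|i is_ H] := IH x pp (lt_le_trans xt tb) _; first by rewrite ltW.
by exists i.+1.
Qed.

(** On each closed slab the extension g is the derivative of f itself, boundary slices included.
    Neighbouring extensions thus agree on the common slice, and the closed pieces glue to one
    continuous function. *)
Lemma PC1_transverse_derivative (f : V -> R^o) (a b : R) : continuous tau -> a < b ->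
  PC1 tau a b f ->
  {within tau @^-1` `[a, b], continuous ('D_v f)} /\
  forall p, a <= tau p <= b -> derivable f p v.
Proof.
move=> ct ab [cf [s pas H]].
have K i : (i < size s)%N -> exists2 g : V -> R^o,
    {within tau @^-1` `[nth b (a :: s) i, nth b s i], continuous g} &
    forall p, nth b (a :: s) i <= tau p <= nth b s i -> is_derive p v f (g p).
  move=> is_; have [g cg fg] := H i is_ v; exists g => //.
  have [ai ii ib] := partition_bounds pas is_.
  exact: (is_derive_closed_slab ai ii ib cf cg fg).
split.
  apply: (within_continuous_partition ct pas ab) => i is_.
  have [g cg fg] := K i is_.
  apply: subspace_eq_continuous cg => p; rewrite inE/= in_itv/= => pi.
  exact: (esym (@derive_val _ _ _ _ _ _ _ (fg p pi))).
move=> p pab; have [i is_ pi] := partition_cover pas ab pab.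
by have [g _ fg] := K i is_; have [] := fg p pi.
Qed.

End Slab.
End Slabs.

(** * Derivatives of piecewise continuously differentiable curves *)

Section Curves.
Variable R : realType.
Local Notation mu := (@lebesgue_measure R).

Lemma continuous_row (T : topologicalType) (n : nat) (f : T -> 'I_n -> R) (t : T) :
  (forall j, {for t, continuous (fun t => f t j)}) ->
  {for t, continuous (fun t => \row_j f t j : 'rV[R]_n)}.
Proof.
move=> cf; apply/cvgrPdist_lt => e e0.
have H : \forall s \near t, forall j, `|f t j - f s j| < e.
  by apply: filter_forall => j; have /cvgrPdist_lt := cf j; apply.
near=> s.
have K : ball (\row_j f t j : 'rV[R]_n) e (\row_j f s j).
  split=> // i j; rewrite !mxE /ball/=; move: j; near: s; exact: H.
by move: K; rewrite mx_norm_ball.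
Unshelve. all: by end_near. Qed.

Lemma measurable_fun_finite_set (D : set R) (f : R -> R) : finite_set D ->
  measurable_fun D f.
Proof.
move=> fD mD Y mY; have fI : finite_set (D `&` f @^-1` Y) by exact: finite_setIl.
exact: countable_measurable (finite_set_countable fI).
Qed.

Lemma measurable_fun_off_finite (D N : set R) (f g : R -> R) : measurable D ->
  measurable_fun D g -> finite_set N ->
  (forall s, D s -> ~ N s -> f s = g s) -> measurable_fun D f.
Proof.
move=> mD mg fN fg.
have mN : measurable N by exact: countable_measurable (finite_set_countable fN).
have -> : D = (D `\` N) `|` (D `&` N) by rewrite setUC setUIDK.
apply/measurable_funU; [exact: measurableD|exact: measurableI|split].
  apply: (eq_measurable_fun g); last by apply: measurable_funS mg.
  by move=> s; rewrite inE => -[Ds Ns]; rewrite fg.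
by apply: measurable_fun_finite_set; exact: finite_setIr.
Qed.

Lemma Rintegral_off_finite (D N : set R) (f g : R -> R) : measurable D ->
  measurable_fun D g -> finite_set N ->
  (forall s, D s -> ~ N s -> f s = g s) ->
  \int[mu]_(s in D) f s = \int[mu]_(s in D) g s.
Proof.
move=> mD mg fN fg; rewrite /Rintegral; congr fine.
apply: ae_eq_integral => //.
- by apply/measurable_EFinP; exact: measurable_fun_off_finite fg.
- by apply/measurable_EFinP.
- by apply: (@ae_finite_set R N) => // s Ns Ds; rewrite /= fg.
Qed.

(* Meant for the derivative of a PC1 curve, which has junk values at the break
   points: X is a globally defined representative. *)
Lemma cutoff_regular (f : R -> R) (a b M : R) (N : set R) : finite_set N ->
  (forall s, a < s < b -> ~ N s -> {for s, continuous f}) ->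
  (forall s, a < s < b -> ~ N s -> `|f s| <= M) ->
  exists X : R -> R, [/\ measurable_fun setT X, forall s, `|X s| <= `|M|,
    forall s, ~ (N `|` [set a; b]) s -> {for s, continuous X},
    forall s, a < s < b -> ~ N s -> X s = f s &
    forall s, ~ (a < s < b) -> X s = 0].
Proof.
move=> fN cf fM.
pose U : set R := `]a, b[%classic `\` N.
have oU : open U.
  rewrite /U setDE; apply: openI; first exact: interval_open.
  apply: closed_openC; apply: (accessible_finite_set_closed.1 _ _ fN).
  exact: hausdorff_accessible (@Rhausdorff R).
pose X := f \_ U.
have XU s : U s -> X s = f s by move=> Us; rewrite /X patchE mem_set.
have XNU s : ~ U s -> X s = 0 by move=> Us; rewrite /X patchE memNset.
exists X; split.
- have mU : measurable U by exact: open_measurable.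
  apply/(measurable_restrictT _ mU); apply: open_continuous_measurable_fun => //.
  by move=> s; rewrite inE => -[]; rewrite /= in_itv/=; exact: cf.
- move=> s; have [Us|Us] := pselect (U s); last by rewrite XNU// normr0.
  rewrite XU//; case: Us; rewrite /= in_itv/= => sab Ns.
  by rewrite (le_trans (fM _ sab Ns))// ler_norm.
- move=> s /not_orP[Ns /not_orP[/eqP sa /eqP sb]].
  have [sab|sab] := boolP (a < s < b).
    have Us : U s by split => //; rewrite /= in_itv.
    have : \forall x \near s, f x = X x.
      by near=> x; rewrite XU//; near: x; exact: open_nbhs_nbhs.
    by move=> /near_eq_continuous; apply; exact: cf.
  have : \forall x \near s, cst 0 x = X x.
    move: sab; rewrite negb_and -!leNgt => /orP[sa'|sb'].
      have lsa : s < a by rewrite lt_neqAle sa.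
      near=> x; rewrite XNU// => -[]; rewrite /= in_itv/= => /andP[ax _] _.
      by move: ax; apply/negP; rewrite -leNgt ltW//; near: x; exact: lt_nbhsl.
    have lsb : b < s by rewrite lt_neqAle eq_sym sb.
    near=> x; rewrite XNU// => -[]; rewrite /= in_itv/= => /andP[_ xb] _.
    by move: xb; apply/negP; rewrite -leNgt ltW//; near: x; exact: lt_nbhsr.
  by move=> /near_eq_continuous; apply; exact: cvg_cst.
- by move=> s sab Ns; rewrite XU//; split => //; rewrite /= in_itv.
- by move=> s sab; rewrite XNU// => -[]; rewrite /= in_itv.
Unshelve. all: by end_near. Qed.

(** Inside each piece the derivative coincides with a function continuous up to the ends, hence
    bounded. The partition points, where the curve may have a corner, form the exceptional set. *)
Lemma PC1_curve_derivative (n : nat) (a b : R) (x : R -> 'rV[R]_n) : a < b ->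
  PC1_curve a b x ->
  exists2 N : set R, finite_set N & exists M : R,
    forall s, a < s < b -> ~ N s ->
    derivable x s 1 /\ forall j, {for s, continuous (fun s => derive1 x s 0 j)} /\
      `|derive1 x s 0 j| <= M.
Proof.
move=> ab [cx [s pas H]].
exists [set` (a :: s)]; first exact: finite_seq.
have K i : exists M : R, (i < size s)%N -> forall t,
    nth b (a :: s) i < t < nth b s i ->
    derivable x t 1 /\ forall j, {for t, continuous (fun s => derive1 x s 0 j)} /\
      `|derive1 x t 0 j| <= M.
  have [is_|] := boolP (i < size s)%N; last by move=> ?; exists 0.
  have [ai ii ib] := partition_bounds pas is_.
  have [/= g cg xg] := H i is_ (1 : R).
  set c := nth b (a :: s) i in ii cg xg *; set d := nth b s i in ii cg xg *.
  have cgj j : {within `[c, d], continuous (fun t => g t 0 j)}.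
    move=> t; apply: (@continuous_comp _ _ _ (g : subspace `[c, d] -> _)
      (fun u : 'rV[R]_n => u 0 j)); [exact: cg|exact: coord_continuous].
  have bd j : exists M, forall t, c <= t <= d -> `|g t 0 j| <= M.
    have [|e _ He] := @EVT_max R (fun t => `|g t 0 j|) c d (ltW ii).
      move=> t; apply: (@continuous_comp _ _ _ ((fun t => g t 0 j) : subspace `[c, d] -> R)
        (fun u : R => `|u|)); [exact: cgj|exact: norm_continuous].
    by exists `|g e 0 j| => t tcd; apply: He; rewrite in_itv.
  have [Mj HM] := choice bd.
  exists (\sum_j `|Mj j|) => _ t tcd.
  have xE : \forall u \near t, derive1 x u = g u.
    case/andP: tcd => ct td; near=> u; rewrite derive1E; apply: derive_val.
    apply: xg; apply/andP; split; near: u; [exact: lt_nbhsr|exact: lt_nbhsl].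
  split; first by have [] := xg t tcd.
  move=> j; split.
    have : \forall u \near t, g u 0 j = derive1 x u 0 j.
      by near=> u; rewrite (_ : derive1 x u = g u)//; near: u; exact: xE.
    move=> /near_eq_continuous; apply.
    by apply: (within_continuous_continuous ii (cgj j)); rewrite in_itv.
  rewrite (nbhs_singleton xE) (le_trans (HM j t _))//.
    by case/andP: tcd => ? ?; rewrite !ltW.
  rewrite (le_trans (ler_norm _))// (bigD1 j)//= lerDl.
  by apply: sumr_ge0.
have [M HM] := choice K.
exists (\sum_(i < size s) `|M i|) => t tab Nt.
have [|i is_ /andP[it ti]] := partition_cover pas ab (t := t).
  by case/andP: tab => ? ?; rewrite !ltW.
have tin : nth b (a :: s) i < t < nth b s i.
  apply/andP; split; rewrite lt_neqAle ?it ?ti andbT; apply/eqP => E; apply: Nt => /=.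
    by rewrite -E mem_nth//= ltnW.
  by rewrite E inE mem_nth ?orbT.
have [dx cx'] := HM i is_ t tin; split => // j; have [? xM] := cx' j; split => //.
rewrite (le_trans xM)// (le_trans (ler_norm _))//.
rewrite (bigD1 (Ordinal is_))//= lerDl; exact: sumr_ge0.
Unshelve. all: by end_near. Qed.

End Curves.

(** * Real kernels and weights *)

Section RealEulerLagrange.
Variable R : realType.
Local Notation mu := (@lebesgue_measure R).

Lemma continuous_comp_within (T U W : topologicalType) (A : set U) (f : U -> W) (c : T -> U) :
  {within A, continuous f} -> continuous c -> (forall z, A (c z)) ->
  continuous (fun z => f (c z)).
Proof.
move=> /subspace_continuousP cf cc Ac z.
apply: cvg_comp (cf (c z) (Ac z)) => B WB.
have H : nbhs z (c @^-1` (fun y => A y -> B y)) := cc z _ WB.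
by apply: (@filterS T (nbhs z) _ _ (c @^-1` B) _ H) => y /=; apply; exact: Ac.
Qed.

(** The direction v is arbitrary because [PC1] on the line asks for the derivative along every real
    v, not only along 1. *)
Lemma is_derive_scaler (n : nat) (h : R -> R) (p v d : R) (v0 : 'rV[R]_n) :
  is_derive p 1 h d -> is_derive (p : R^o) (v : R^o) (fun s : R^o => h s *: v0) ((v * d) *: v0).
Proof.
move=> dh.
have dfh : differentiable h p by apply/derivable1_diffP; case: dh.
have H : is_derive (p : R^o) (v : R^o) (h : R^o -> R^o) (v * d).
  apply: DeriveDef; first exact: diff_derivable.
  rewrite deriveE// -[X in 'd h p X]mulr1 -[v * 1]/(v *: (1 : R^o)) linearZ/= -deriveE//.
  by rewrite (@derive_val _ _ _ _ _ _ _ dh).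
move/is_deriveE : H => H; apply/is_deriveE.
have -> : (fun k : R => k^-1 *: (h (k *: (v : R^o) + p) *: v0 - h p *: v0)) =
  (fun k : R => (k^-1 *: (h (k *: (v : R^o) + p) - h p)) *: v0).
  by apply/funext => k; rewrite -scalerBl scalerA.
by apply: cvgZr_tmp.
Qed.

Lemma PC1_curve_perturb (n : nat) (a b : R) (x : R -> 'rV[R]_n) (h h' : R -> R) (v0 : 'rV[R]_n) :
  PC1_curve a b x -> (forall s : R, is_derive s 1 h (h' s)) -> continuous h' ->
  PC1_curve a b (fun s => x s + h s *: v0).
Proof.
move=> [cx [s pas H]] dh ch'.
have cs (k : R -> R) : continuous k -> continuous (fun s => k s *: v0).
  by move=> ck t; apply: cvgZr_tmp; exact: ck.
have ch : continuous h by move=> t; exact: is_derive_continuous (dh t).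
split.
  apply: (within_continuousD cx); apply: continuous_subspaceT; exact: cs.
exists s => // i is_ /= v; have [g cg xg] := H i is_ v.
exists (fun p => g p + (v * h' p) *: v0).
  apply: (within_continuousD cg); apply: continuous_subspaceT.
  by apply: cs => t; apply: cvgM; [exact: cvg_cst|exact: ch'].
move=> p pcd; apply: (@is_deriveD _ _ _ _ _ p v _ _ (xg p pcd)).
exact: is_derive_scaler.
Qed.

Lemma derive1_perturb (n : nat) (x : R -> 'rV[R]_n) (h : R -> R) (d s : R) (v0 : 'rV[R]_n) :
  derivable x s 1 -> is_derive s 1 h d ->
  derive1 (fun s => x s + h s *: v0) s = derive1 x s + d *: v0.
Proof.
move=> dx dh; have [d1 d2] := is_derive_scaler 1 v0 dh.
by rewrite !derive1E (@deriveD _ _ _ x _ s 1 dx d1) d2 mul1r.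
Qed.

Section Kernel.
Variables (a b : R) (kr : R -> R).
Hypotheses (ab : a < b) (kr0 : kr 0 = 0).
Hypothesis ik : mu.-integrable `]0, (b - a)] (EFin \o kr).
Hypothesis ck : forall r : R, 0 < r <= b - a -> {for r, continuous kr}.

(** Only lags in [0, b - a] occur in the integrals over [a, t]. Cutting there makes the kernel
    causal and integrable on the line; omitting the lag 0 changes nothing, as [kr] vanishes at 0. *)
Definition cutoff_kernel (r : R) : R := \1_`]0, (b - a)] r * kr r.
Local Notation K := cutoff_kernel.

Lemma cutoff_kernelE (r : R) : 0 <= r <= b - a -> K r = kr r.
Proof.
move=> /andP[]; rewrite le_eqVlt => /predU1P[<- _|r0 rL].
  by rewrite /K kr0 mulr0.
by rewrite /K indicE mem_setE in_itv/= r0 rL mul1r.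
Qed.

Lemma cutoff_kernel_eq0 (r : R) : r <= 0 -> K r = 0.
Proof. by move=> r0; rewrite /K indicE mem_setE in_itv/= ltNge r0 mul0r. Qed.

Lemma integrable_cutoff_kernel : mu.-integrable setT (EFin \o K).
Proof. exact: (integrable_indicM kr (measurable_itv _)).1. Qed.

Lemma cutoff_kernel_continuous (r : R) : ~ [set 0; b - a] r -> {for r, continuous K}.
Proof.
move=> /not_orP[/eqP r0 /eqP rL].
have [rlt0|] := ltP r 0.
  have : \forall x \near r, cst 0 x = K x.
    by near=> x; rewrite cutoff_kernel_eq0// ltW//; near: x; exact: lt_nbhsl.
  by move=> /near_eq_continuous; apply; exact: cvg_cst.
rewrite le_eqVlt eq_sym (negbTE r0)/= => {}r0.
have [rltL|] := ltP r (b - a).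
  have : \forall x \near r, kr x = K x.
    near=> x; rewrite cutoff_kernelE//; apply/andP; split; apply: ltW; near: x.
      exact: lt_nbhsr.
    exact: lt_nbhsl.
  by move=> /near_eq_continuous; apply; apply: ck; rewrite r0 ltW.
rewrite le_eqVlt eq_sym (negbTE rL)/= => {}rL.
have : \forall x \near r, cst 0 x = K x.
  near=> x; rewrite /K indicE mem_setE in_itv/= andbC leNgt.
  have -> : b - a < x by near: x; exact: lt_nbhsr.
  by rewrite mul0r.
by move=> /near_eq_continuous; apply; exact: cvg_cst.
Unshelve. all: by end_near. Qed.

Lemma cutoff_kernel_bounded (d : R) : 0 < d ->
  exists B : R, forall r : R, d <= r -> `|K r| <= B.
Proof.
move=> d0; have [|B HB] := @bounded_on_segment R kr d (b - a).
  by move=> t /andP[dt tL]; apply: ck; rewrite tL (lt_le_trans d0).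
exists `|B| => r dr; have [rL|Lr] := leP r (b - a).
  rewrite cutoff_kernelE; last by rewrite rL (le_trans (ltW d0)).
  by rewrite (le_trans (HB _ _)) ?ler_norm// dr.
by rewrite /K indicE mem_setE in_itv/= andbC [r <= b - a]leNgt Lr mul0r normr0.
Qed.

(** The limits of integration become automatic: [X] vanishes before a and the cut-off kernel
    vanishes at negative lags. The finitely many points where [X] differs from f are not seen by the
    integral. *)
Lemma cutoff_convolution (f X : R -> R) (N : set R) (t : R) : a <= t <= b ->
  finite_set N -> measurable_fun setT X ->
  (forall s, a < s < b -> ~ N s -> X s = f s) ->
  (forall s, ~ (a < s < b) -> X s = 0) ->
  \int[mu]_(s in `[a, t]) (kr (t - s) * f s) = \int[mu]_s (K (t - s) * X s).
Proof.
move=> /andP[at_ tb] fN mX Xf X0.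
have mK : measurable_fun setT K.
  by apply/measurable_EFinP; exact: measurable_int integrable_cutoff_kernel.
rewrite (_ : \int[mu]_s (K (t - s) * X s) = \int[mu]_(s in `[a, t]) (K (t - s) * X s)); last first.
  rewrite [RHS]Rintegral_indicM; apply: eq_Rintegral => s _.
  rewrite indicE mem_setE in_itv/=.
  have [as_|sa] := leP a s; last first.
    by rewrite X0 ?mulr0// => /andP[/lt_trans /(_ sa)]; rewrite ltxx.
  have [st|ts] := leP s t; first by rewrite mul1r.
  by rewrite cutoff_kernel_eq0 ?mul0r ?mulr0//; lra.
apply: (@Rintegral_off_finite R `[a, t]%classic (N `|` [set a; b])).
- exact: measurable_itv.
- apply: measurable_funM; last exact: measurable_funTS.
  by apply: measurable_funTS; apply: measurableT_comp => //; exact: measurable_funB.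
- by rewrite !finite_setU.
- move=> s; rewrite /= in_itv/= => /andP[as_ st] /not_orP[Ns /not_orP[/eqP sa /eqP sb]].
  rewrite Xf//.
    by rewrite cutoff_kernelE//; apply/andP; split; lra.
  by rewrite !lt_neqAle eq_sym sa sb as_ (le_trans st).
Qed.

(** A convolution is a cross-correlation with the reflected kernel. *)
Lemma continuous_convolution (X : R -> R) (M : R) (N : set R) :
  measurable_fun setT X -> (forall x, `|X x| <= M) -> finite_set N ->
  (forall x, ~ N x -> {for x, continuous X}) ->
  continuous (fun t : R => \int[mu]_s (K (t - s) * X s)).
Proof.
move=> mX XM fN cX.
have ik' := integrable_reflect 0 integrable_cutoff_kernel.
rewrite (_ : (fun t => _) = (fun s : R => \int[mu]_t (K (0 - (t - s)) * X t))).
  exact: continuous_cross mX XM fN cX ik'.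
by apply/funext => t; apply: eq_Rintegral => s _; rewrite sub0r opprB.
Qed.

End Kernel.

End RealEulerLagrange.

(** * The Euler-Lagrange equation for a real kernel and a real weight *)

Section RealProblem.
Variable R : realType.
Local Notation mu := (@lebesgue_measure R).

Definition clamp (a b t : R) : R := Num.max a (Num.min t b).

Lemma clamp_continuous (a b : R) : continuous (clamp a b).
Proof.
move=> t; apply: (@continuous_comp _ _ _ (fun t => Num.min t b) (fun s => Num.max a s)).
  by apply: continuous_min; [exact: cvg_id|exact: cvg_cst].
by apply: continuous_max; [exact: cvg_cst|exact: cvg_id].
Qed.

Lemma clampE (a b t : R) : a <= t <= b -> clamp a b t = t.
Proof. by move=> /andP[at_ tb]; rewrite /clamp min_l// max_r. Qed.

Lemma clamp_itv (a b t : R) : a <= b -> a <= clamp a b t <= b.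
Proof. by move=> ab; rewrite /clamp le_max lexx ge_max ab ge_min lexx orbT. Qed.

(** A directional derivative sees a single line. This identifies the entries of the gradients of the
    slices of L with derivatives of L on the product space. *)
Lemma derive_eq_along (V V' W : normedModType R) (f : V -> W) (g : V' -> W)
    (p v : V) (q v' : V') : (forall r : R, f (r *: v + p) = g (r *: v' + q)) ->
  'D_v f p = 'D_v' g q.
Proof.
move=> fg; have fg0 : f p = g q by have := fg 0; rewrite !scale0r !add0r.
rewrite /derive.
have -> : (fun h : R => h^-1 *: ((f \o shift p) (h *: v) - f p)) =
    (fun h : R => h^-1 *: ((g \o shift q) (h *: v') - g q)).
  by apply/funext => h /=; rewrite fg fg0.
by [].
Qed.

Definition memory_derivative (n : nat) (a : R) (k : R -> R) (x : R -> 'rV[R]_n) (t : R) :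
    'rV[R]_n :=
  \row_j \int[mu]_(s in `[a, t]) (k (t - s) * derive1 x s 0 j).

Theorem real_euler_lagrange (n : nat) (a b : R) (k w : R -> R)
    (L : R -> 'rV[R]_n -> 'rV[R]_n -> R) (x : R -> 'rV[R]_n) :
  a < b -> k 0 = 0 ->
  mu.-integrable `]0, (b - a)] (EFin \o k) ->
  (forall r : R, 0 < r <= b - a -> {for r, continuous k}) ->
  mu.-integrable `[a, b] (EFin \o w) ->
  (forall t : R, a <= t < b -> {for t, continuous w}) ->
  PC1_lagrangian a b L -> PC1_curve a b x ->
  let u := memory_derivative a k in
  (forall y, PC1_curve a b y -> y a = x a -> y b = x b ->
     \int[mu]_(t in `[a, b]) (w t * L t (y t) (u y t)) <=
     \int[mu]_(t in `[a, b]) (w t * L t (x t) (u x t))) ->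
  forall (i : 'I_n) (t : R), a <= t < b ->
  (fun s => (s - t)^-1 *
     (\int[mu]_(r in `[s, b]) (k (r - s) * (w r * gradu L r (x r) (u x r) 0 i)) -
      \int[mu]_(r in `[t, b]) (k (r - t) * (w r * gradu L r (x r) (u x r) 0 i))))
    @ within `[a, b] t^' --> w t * gradx L t (x t) (u x t) 0 i.
Proof.
move=> ab k0 ik ck iw cw PL Px u xmax i.
pose V : normedModType R := (R^o * 'rV[R]_n * 'rV[R]_n)%type.
pose tau (p : V) : R := p.1.1.
pose f (p : V) : R^o := L p.1.1 p.1.2 p.2.
pose ei : 'rV[R]_n := delta_mx 0 i.
(* [e0] moves time at unit speed, as the slab lemmas require; [v1] and [v2] are the directions of
   x_i and u_i at a fixed time. *)
pose e0 : V := ((1 : R^o), 0, 0).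
pose v1 : V := ((0 : R^o), ei, 0).
pose v2 : V := ((0 : R^o), 0, ei).
have ct : continuous tau.
  by move=> p; apply: (@continuous_comp _ _ _ fst fst); exact: cvg_fst.
have te0 (p : V) (r : R) : tau (p + r *: e0) = tau p + r.
  by rewrite /tau /= /GRing.scale/= mulr1.
have tv1 (p : V) (r : R) : tau (p + r *: v1) = tau p.
  by rewrite /tau /= /GRing.scale/= mulr0 addr0.
have tv2 (p : V) (r : R) : tau (p + r *: v2) = tau p.
  by rewrite /tau /= /GRing.scale/= mulr0 addr0.
have [cD1 dD1] := PC1_transverse_derivative te0 tv1 ct ab PL.
have [cD2 dD2] := PC1_transverse_derivative te0 tv2 ct ab PL.
have cf : {within tau @^-1` `[a, b], continuous f} by case: PL.
have [N fN [M HN]] := PC1_curve_derivative ab Px.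
have Xex (j : 'I_n) : exists X : R -> R, [/\ measurable_fun setT X, forall s, `|X s| <= `|M|,
    forall s, ~ (N `|` [set a; b]) s -> {for s, continuous X},
    forall s, a < s < b -> ~ N s -> X s = derive1 x s 0 j &
    forall s, ~ (a < s < b) -> X s = 0].
  apply: cutoff_regular => // s sab Ns; have [_ /(_ j)[]] := HN s sab Ns; done.
have [X HX] := choice Xex.
pose K := cutoff_kernel a b k.
have fNab : finite_set (N `|` [set a; b]) by rewrite !finite_setU.
(* [X j] stands for the j-th component of x', which makes [U] a continuous function on the whole
   line that agrees with [u x] on [a, b]. *)
pose U t : 'rV[R]_n := \row_j \int[mu]_s (K (t - s) * X j s).
have UE t : a <= t <= b -> u x t = U t.
  move=> tab; apply/rowP => j; rewrite !mxE; have [mX _ _ Xf X0] := HX j.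
  exact: (cutoff_convolution k0 ik tab fN mX Xf X0).
have cU : continuous U.
  move=> t; apply: continuous_row => j; have [mX XM cX _ _] := HX j.
  by apply: (continuous_convolution ik mX XM fNab cX).
pose cl := clamp a b.
have ccl : continuous cl by exact: clamp_continuous.
have cli t : a <= cl t <= b by apply: clamp_itv; exact: ltW.
have clE t : a <= t <= b -> cl t = t by exact: clampE.
have cxcl : continuous (fun t => x (cl t)).
  apply: (continuous_comp_within Px.1 ccl) => t.
  by rewrite /= in_itv/=; exact: cli.
have cUcl : continuous (fun t => U (cl t)).
  by move=> t; apply: continuous_comp; [exact: ccl|exact: cU].
(* The clamp in t makes everything that is only continuous within [a, b]
   continuous on the whole space. *)
pose pt (z : R * R * R) : V :=
  ((cl z.1.1 : R^o), x (cl z.1.1) + z.1.2 *: ei, U (cl z.1.1) + z.2 *: ei).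
have cz1 : continuous (fun z : R * R * R => z.1.1).
  by move=> z; apply: (@continuous_comp _ _ _ fst fst); exact: cvg_fst.
have cz2 : continuous (fun z : R * R * R => z.1.2).
  by move=> z; apply: (@continuous_comp _ _ _ fst snd); [exact: cvg_fst|exact: cvg_snd].
have cz3 : continuous (fun z : R * R * R => z.2) by move=> z; exact: cvg_snd.
have cpt : continuous pt.
  move=> z.
  have c1 : {for z, continuous (fun z : R * R * R => (cl z.1.1 : R^o))}.
    by apply: (@continuous_comp _ _ _ (fun z : R * R * R => z.1.1) cl); [exact: cz1|exact: ccl].
  have c2 : {for z, continuous (fun z : R * R * R => x (cl z.1.1) + z.1.2 *: ei)}.
    apply: cvgD; last by apply: cvgZr_tmp; exact: cz2.
    by apply: (@continuous_comp _ _ _ (fun z : R * R * R => z.1.1) (fun t => x (cl t)));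
      [exact: cz1|exact: cxcl].
  have c3 : {for z, continuous (fun z : R * R * R => U (cl z.1.1) + z.2 *: ei)}.
    apply: cvgD; last by apply: cvgZr_tmp; exact: cz3.
    by apply: (@continuous_comp _ _ _ (fun z : R * R * R => z.1.1) (fun t => U (cl t)));
      [exact: cz1|exact: cUcl].
  have c12 : {for z, continuous (fun z : R * R * R =>
    ((cl z.1.1 : R^o), x (cl z.1.1) + z.1.2 *: ei))} by exact: (cvg_pair c1 c2).
  exact: (cvg_pair c12 c3).
have ptA z : (tau @^-1` `[a, b]) (pt z) by rewrite /tau /pt /= in_itv/=; exact: cli.
pose Phi z : R := f (pt z).
pose Phi1 z : R := 'D_v1 f (pt z).
pose Phi2 z : R := 'D_v2 f (pt z).
have cPhi : continuous Phi by exact: continuous_comp_within cf cpt ptA.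
have cPhi1 : continuous Phi1 by exact: continuous_comp_within cD1 cpt ptA.
have cPhi2 : continuous Phi2 by exact: continuous_comp_within cD2 cpt ptA.
have dPhi1 (t al be : R) : a <= t <= b ->
    is_derive al 1 (fun al => Phi (t, al, be)) (Phi1 (t, al, be)).
  move=> _.
  have E r : pt (t, r, be) = pt (t, 0, be) + r *: v1.
    rewrite /pt /v1 /=; congr (_, _, _).
    - by rewrite /= scaler0 addr0.
    - by rewrite /= scale0r addr0.
    - by rewrite /= scaler0 addr0.
  rewrite (_ : (fun al => _) = fun r => f (pt (t, 0, be) + r *: v1)); last first.
    by apply/funext => r; rewrite /Phi E.
  apply: is_derive_line; rewrite -E /Phi1.
  apply: DeriveDef => //; apply: dD1; exact: cli.
have dPhi2 (t al be : R) : a <= t <= b ->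
    is_derive be 1 (fun be => Phi (t, al, be)) (Phi2 (t, al, be)).
  move=> _.
  have E r : pt (t, al, r) = pt (t, al, 0) + r *: v2.
    rewrite /pt /v2 /=; congr (_, _, _).
    - by rewrite /= scaler0 addr0.
    - by rewrite /= scaler0 addr0.
    - by rewrite /= scale0r addr0.
  rewrite (_ : (fun be => _) = fun r => f (pt (t, al, 0) + r *: v2)); last first.
    by apply/funext => r; rewrite /Phi E.
  apply: is_derive_line; rewrite -E /Phi2.
  apply: DeriveDef => //; apply: dD2; exact: cli.
pose P1 t := Phi1 (t, 0, 0).
pose P2 t := Phi2 (t, 0, 0).
have c0 : continuous (fun _ : R => 0 : R) by move=> t; exact: cvg_cst.
have cP1 : continuous P1 by exact: (continuous_curve cPhi1 c0 c0).
have cP2 : continuous P2 by exact: (continuous_curve cPhi2 c0 c0).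
have pt0 t : a <= t <= b -> pt (t, 0, 0) = ((t : R^o), x t, u x t).
  by move=> tab; rewrite /pt /= clE// !scale0r !addr0 UE.
have P1E t : a <= t <= b -> P1 t = gradx L t (x t) (u x t) 0 i.
  move=> tab; rewrite /P1 /Phi1 pt0// /gradx /gradient mxE.
  by apply: derive_eq_along => r; rewrite /f /v1 /= !scaler0 !add0r.
have P2E t : a <= t <= b -> P2 t = gradu L t (x t) (u x t) 0 i.
  move=> tab; rewrite /P2 /Phi2 pt0// /gradu /gradient mxE.
  by apply: derive_eq_along => r; rewrite /f /v2 /= !scaler0 !add0r.
have fin0 : finite_set (set0 : set R) by [].
have variation (h h' : R -> R) : (forall s : R, is_derive s 1 h (h' s)) -> continuous h' ->
     h a = 0 -> h b = 0 ->
     \int[mu]_(t in `[a, b])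
       (w t * (P1 t * h t + P2 t * \int[mu]_(s in `[a, t]) (K (t - s) * h' s))) = 0.
  move=> dh ch' ha hb.
  have ch : continuous h by move=> t; exact: is_derive_continuous (dh t).
  have [B HB] := bounded_on_segment (fun (t : R) (_ : a <= t <= b) => ch' t).
  (* h' is continuous but need not vanish outside [a, b]; [Y] is its cut-off, with no exceptional
     points besides a and b. *)
  have [Y [mY YM cY Yf Y0]] : exists X : R -> R, [/\ measurable_fun setT X,
    forall s, `|X s| <= `|B|,
    forall s, ~ (set0 `|` [set a; b]) s -> {for s, continuous X},
    forall s, a < s < b -> ~ set0 s -> X s = h' s &
    forall s, ~ (a < s < b) -> X s = 0].
    apply: cutoff_regular => // s /andP[as_ sb] _; first exact: ch'.
    by apply: HB; rewrite !ltW.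
  pose z t := \int[mu]_s (K (t - s) * Y s).
  have fab : finite_set (set0 `|` [set a; b]) by rewrite !finite_setU.
  have cz : continuous z by exact: (continuous_convolution ik mY YM fab cY).
  have zE (t : R) : a <= t <= b -> \int[mu]_(s in `[a, t]) (k (t - s) * h' s) = z t.
    by move=> tab; exact: (cutoff_convolution k0 ik tab fin0 mY Yf Y0).
  have := first_variation iw cPhi cPhi1 cPhi2 dPhi1 dPhi2 ch cz.
  rewrite (_ : \int[mu]_(t in `[a, b]) (w t * (P1 t * _ + _)) =
    \int[mu]_(t in `[a, b]) (w t * (Phi1 (t, 0, 0) * h t + Phi2 (t, 0, 0) * z t))); last first.
    apply: eq_Rintegral => t; rewrite inE/= in_itv/= => tab.
    rewrite -zE//; congr (_ * (_ + _ * _)); apply: eq_Rintegral => s.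
    rewrite inE/= in_itv/= => /andP[as_ st]; rewrite /K cutoff_kernelE//.
    by case/andP: tab => ? ?; apply/andP; split; lra.
  apply => e.
  pose y s := x s + (e * h s) *: ei.
  have deh (s : R) : is_derive s 1 (fun s => e * h s) (e * h' s).
    exact: (@is_deriveZ _ _ _ _ e s 1 _ (dh s)).
  have ceh : continuous (fun s => e * h' s).
    by move=> s; apply: cvgM; [exact: cvg_cst|exact: ch'].
  have Py : PC1_curve a b y by exact: PC1_curve_perturb deh ceh.
  have := xmax y Py; rewrite /y ha hb mulr0 scale0r !addr0 => /(_ erefl erefl).
  rewrite [X in _ <= X -> _](_ : _ = \int[mu]_(t in `[a, b]) (w t * Phi (t, 0, 0))); last first.
    apply: eq_Rintegral => t; rewrite inE/= in_itv/= => tab.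
    by rewrite /Phi pt0.
  rewrite [X in X <= _ -> _](_ : _ = \int[mu]_(t in `[a, b]) (w t * Phi (t, e * h t, e * z t)))//.
  apply: eq_Rintegral => t; rewrite inE/= in_itv/= => tab; congr (_ * _).
  rewrite /Phi /f /pt /= clE//; congr (L _ _ _).
  apply/rowP => j; rewrite !mxE -zE//.
  have [mX XM cX Xf X0] := HX j.
  (* Off [N] the derivative of the perturbed curve is affine in e. At the points of [N], [derive1]
     may be junk for both curves, which the integral ignores. *)
  have yE : forall s, a < s < b -> ~ N s ->
      X j s + (e * (ei 0 j)) * Y s = derive1 (fun s => x s + (e * h s) *: ei) s 0 j.
    move=> s sab Ns; have [dx _] := HN s sab Ns.
    rewrite (derive1_perturb _ dx (deh s)) !mxE Xf// Yf//; ring.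
  pose Z s := X j s + (e * (ei 0 j)) * Y s.
  have mZ : measurable_fun setT Z by apply: measurable_funD => //; apply: measurable_funM.
  have Z0 s : ~ (a < s < b) -> Z s = 0 by move=> sab; rewrite /Z X0// Y0// mulr0 addr0.
  rewrite (cutoff_convolution k0 ik tab fN mZ yE Z0) -/K.
  rewrite (cutoff_convolution k0 ik tab fin0 mY Yf Y0) -/K.
  have iKX (G : R -> R) (B' : R) : measurable_fun setT G -> (forall s, `|G s| <= B') ->
      mu.-integrable setT (EFin \o (fun s => K (t - s) * G s)).
    move=> mG GB; rewrite (_ : EFin \o _ = EFin \o (fun s => G s * K (t - s))).
      apply: (@integrable_boundedM _ setT G _ B') => //.
      exact: (integrable_reflect t (integrable_cutoff_kernel ik)).
    by apply/funext => s /=; rewrite mulrC.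
  transitivity (\int[mu]_s (K (t - s) * X j s) + (e * ei 0 j) * \int[mu]_s (K (t - s) * Y s)).
    rewrite -RintegralZl//; last exact: iKX YM.
    rewrite -RintegralD//; last 2 first.
    - exact: iKX XM.
    - apply: (@integrable_boundedM _ setT (fun=> e * ei 0 j) _ `|e * ei 0 j|) => //.
      exact: iKX YM.
    by apply: eq_Rintegral => s _; rewrite /Z; ring.
  by rewrite !mxE; ring.
have f0L : finite_set [set 0; b - a] by rewrite finite_setU; split.
move=> t tab.
have := @euler_lagrange_of_first_variation R a b K w P1 P2 [set 0; b - a] ab
  (integrable_cutoff_kernel ik) (@cutoff_kernel_eq0 R a b k) f0L
  (fun r => @cutoff_kernel_continuous R a b k k0 ck r)
  (cutoff_kernel_bounded k0 ck) iw cw cP1 cP2 variation t tab.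
rewrite P1E; last by case/andP: tab => -> /ltW.
have PE s : a <= s <= b ->
    \int[mu]_(r in `[s, b]) (K (r - s) * (w r * P2 r)) =
    \int[mu]_(r in `[s, b]) (k (r - s) * (w r * gradu L r (x r) (u x r) 0 i)).
  move=> /andP[as_ sb]; apply: eq_Rintegral => r; rewrite inE/= in_itv/= => /andP[sr rb].
  rewrite P2E; last by rewrite rb (le_trans as_).
  by rewrite /K cutoff_kernelE//; apply/andP; split; lra.
apply: cvg_trans; apply: near_eq_cvg.
rewrite near_withinE; near=> s; rewrite /= in_itv/= => sab.
by rewrite !PE//; case/andP: tab => -> /ltW.
Unshelve. all: by end_near. Qed.

End RealProblem.

(** * Complex kernels *)

Local Open Scope complex_scope.

Section ComplexKernels.
Variable R : realType.
Local Notation mu := (@lebesgue_measure R).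
Local Notation Re := (@complex.Re R).
Local Notation Im := (@complex.Im R).
Implicit Types (z beta : R[i]).

Lemma Re_le_normC z (r : R) : `|z| <= r%:C -> `|Re z| <= r.
Proof.
rewrite normc_def lecR; apply: le_trans.
by rewrite -sqrtr_sqr ler_wsqrtr// lerDl sqr_ge0.
Qed.

Lemma Im_le_normC z (r : R) : `|z| <= r%:C -> `|Im z| <= r.
Proof.
rewrite normc_def lecR; apply: le_trans.
by rewrite -sqrtr_sqr ler_wsqrtr// lerDr sqr_ge0.
Qed.

Lemma normC_real (r : R) : `|r%:C : R[i]| = `|r|%:C.
Proof. by rewrite normc_def /= expr0n addr0 sqrtr_sqr. Qed.

Lemma normC_lt (z : R[i]) (e : R) : `|Re z| < e / 2 -> `|Im z| < e / 2 -> `|z| < e%:C.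
Proof.
move=> rz iz; have -> : z = (Re z)%:C + (Im z)%:C * 'i%C.
  by case: z {rz iz} => x y; simpc.
rewrite (le_lt_trans (ler_normD _ _))// normrM !normC_real normc_def /=.
rewrite expr0n add0r expr1n sqrtr1 -[1%:C]/(1 : R[i]) mulr1 -rmorphD/= ltcR; lra.
Qed.

Lemma ReM z z' : Re (z * z') = Re z * Re z' - Im z * Im z'.
Proof. by case: z; case: z'. Qed.

Lemma ImM z z' : Im (z * z') = Re z * Im z' + Im z * Re z'.
Proof. by case: z; case: z'. Qed.

Lemma ReD z z' : Re (z + z') = Re z + Re z'.
Proof. by case: z; case: z'. Qed.

Lemma ImD z z' : Im (z + z') = Im z + Im z'.
Proof. by case: z; case: z'. Qed.

Lemma ReN z : Re (- z) = - Re z.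
Proof. by case: z. Qed.

Lemma ImN z : Im (- z) = - Im z.
Proof. by case: z. Qed.

Lemma ReMr z (r : R) : Re (z * r%:C) = Re z * r.
Proof. by rewrite ReM /= mulr0 subr0. Qed.

Lemma ImMr z (r : R) : Im (z * r%:C) = Im z * r.
Proof. by rewrite ImM /= mulr0 add0r. Qed.

Lemma ReMl (r : R) z : Re (r%:C * z) = r * Re z.
Proof. by rewrite mulrC ReMr mulrC. Qed.

Lemma ImMl (r : R) z : Im (r%:C * z) = r * Im z.
Proof. by rewrite mulrC ImMr mulrC. Qed.

Lemma normC_cpow (s : R) beta : `|cpow s beta| = (s `^ Re beta)%:C.
Proof.
rewrite /cpow normrM normC_real (ger0_norm (powR_ge0 _ _)).
by rewrite -[RHS]mulr1; congr (_ * _); rewrite normc_def /= cos2Dsin2 sqrtr1.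
Qed.

(** The factor k = 0 of the product is z itself, so at z = 0 every term of Gauss' sequence is a
    division by 0, with value 0. *)
Lemma Gamma0 : Gamma (0 : R[i]) = 0.
Proof.
rewrite /Gamma.
have H : (fun n : nat => (n`!%:R * cpow n%:R (0 : R[i]) /
    \prod_(k < n.+1) ((0 : R[i]) + k%:R) : R[i]^o)) @ \oo --> (0 : R[i]^o).
  rewrite (_ : (fun n : nat => _) = fun=> (0 : R[i]^o)); first exact: cvg_cst.
  by apply/funext => n; rewrite big_ord_recl /= addr0 mul0r invr0 mulr0.
exact: cvg_lim H.
Qed.

(** Stated on the parts, since [Cintegral] integrates the real and imaginary parts separately and
    the real theorem is applied to each. *)
Definition ccontinuous (f : R -> R[i]) (s : R) :=
  {for s, continuous (fun x => Re (f x))} /\ {for s, continuous (fun x => Im (f x))}.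

Lemma ccontinuous_cst z s : ccontinuous (fun=> z) s.
Proof. by split; exact: cvg_cst. Qed.

Lemma ccontinuousD (f g : R -> R[i]) s : ccontinuous f s -> ccontinuous g s ->
  ccontinuous (fun x => f x + g x) s.
Proof.
move=> [rf jf] [rg jg]; split.
  have -> : (fun x => Re (f x + g x)) = (fun x => Re (f x) + Re (g x)).
    by apply/funext => x; exact: ReD.
  exact: cvgD.
have -> : (fun x => Im (f x + g x)) = (fun x => Im (f x) + Im (g x)).
  by apply/funext => x; exact: ImD.
exact: cvgD.
Qed.

Lemma ccontinuousM (f g : R -> R[i]) s : ccontinuous f s -> ccontinuous g s ->
  ccontinuous (fun x => f x * g x) s.
Proof.
move=> [rf jf] [rg jg]; split.
  have -> : (fun x => Re (f x * g x)) = (fun x => Re (f x) * Re (g x) - Im (f x) * Im (g x)).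
    by apply/funext => x; exact: ReM.
  by apply: cvgB; apply: cvgM.
have -> : (fun x => Im (f x * g x)) = (fun x => Re (f x) * Im (g x) + Im (f x) * Re (g x)).
  by apply/funext => x; exact: ImM.
by apply: cvgD; apply: cvgM.
Qed.

Lemma ccontinuousX (f : R -> R[i]) s n : ccontinuous f s -> ccontinuous (fun x => f x ^+ n) s.
Proof.
move=> cf; elim: n => [|n IH]; first exact: ccontinuous_cst.
rewrite (_ : (fun x => _) = fun x => f x * f x ^+ n); first exact: ccontinuousM.
by apply/funext => x; rewrite exprS.
Qed.

Lemma ccontinuous_sum (f : nat -> R -> R[i]) s N : (forall n, ccontinuous (f n) s) ->
  ccontinuous (fun x => \sum_(n < N) f n x) s.
Proof.
move=> cf; elim: N => [|N IH].
  rewrite (_ : (fun x => _) = fun=> 0); first exact: ccontinuous_cst.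
  by apply/funext => x; rewrite big_ord0.
rewrite (_ : (fun x => _) = fun x => \sum_(n < N) f n x + f N x).
  exact: ccontinuousD.
by apply/funext => x; rewrite big_ord_recr.
Qed.

Lemma powR_continuous (p s : R) : 0 < s -> {for s, continuous (fun x => x `^ p)}.
Proof. by move=> s0; apply: is_derive_continuous; exact: is_derive1_powR. Qed.

Lemma ccontinuous_real (f : R -> R) s : {for s, continuous f} ->
  ccontinuous (fun x => (f x)%:C) s.
Proof. by move=> cf; split => //=; exact: cvg_cst. Qed.

Lemma ccontinuous_cpow beta (s : R) : 0 < s -> ccontinuous (fun x => cpow x beta) s.
Proof.
move=> s0; apply: ccontinuousM; first by apply: ccontinuous_real; exact: powR_continuous.
have cln : {for s, continuous (fun x => Im beta * ln x)}.
  by apply: cvgM; [exact: cvg_cst|exact: continuous_ln].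
split => /=.
  by apply: (@continuous_comp _ _ _ (fun x => Im beta * ln x) cos) => //; exact: continuous_cos.
by apply: (@continuous_comp _ _ _ (fun x => Im beta * ln x) sin) => //; exact: continuous_sin.
Qed.

Lemma power_series_uniform (rho r : R) (A : R[i] -> R[i]) (c : nat -> R[i]) (e : R) :
  has_power_series rho A c -> 0 < r < rho -> 0 < e ->
  exists N, forall z, `|z| <= r%:C -> `|A z - \sum_(n < N) c n * z ^+ n| < e%:C.
Proof.
move=> HA rr e0.
have e0' : 0 < e%:C :> R[i] by rewrite ltcR.
have [N _ HN] : ((fun (N : nat) z => (\sum_(n < N) c n * z ^+ n : R[i]^o)) @ \oo)
    [set h | forall z, `|z| <= r%:C -> `|A z - h z| < e%:C].
  apply: (HA r rr); apply/uniform_nbhs.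
  exists [set xy : R[i]^o * R[i]^o | ball xy.1 e%:C xy.2]; split.
    exact: (entourage_ball _ (PosNum e0')).
  by move=> h Hh z zr; exact: Hh.
by exists N => z zr; exact: (HN N (leqnn N)).
Qed.

Lemma power_series_bounded (rho r : R) (A : R[i] -> R[i]) (c : nat -> R[i]) :
  has_power_series rho A c -> 0 < r < rho ->
  exists M : R, forall z, `|z| <= r%:C -> `|Re (A z)| <= M /\ `|Im (A z)| <= M.
Proof.
move=> HA rr; have [N HN] := power_series_uniform HA rr ltr01.
have r0 : 0 <= r by case/andP: rr => /ltW.
(* The summand 1 is the uniform distance from A to the chosen partial sum on the closed disc; the
   rest bounds that partial sum. *)
pose Q : R[i] := 1 + \sum_(n < N) `|c n| * r%:C ^+ n.
have rQ : (Re Q)%:C = Q.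
  apply: RRe_real; apply: ger0_real; rewrite addr_ge0// sumr_ge0// => n _.
  by rewrite mulr_ge0// exprn_ge0// ler0c.
exists (Re Q) => z zr.
have AQ : `|A z| <= (Re Q)%:C.
  rewrite rQ -[A z](subrK (\sum_(n < N) c n * z ^+ n)) (le_trans (ler_normD _ _))//.
  apply: lerD; first exact/ltW/HN.
  rewrite (le_trans (ler_norm_sum _ _ _))// ler_sum// => n _.
  by rewrite normrM normrX ler_wpM2l// lerXn2r// nnegrE ler0c.
by split; [exact: Re_le_normC|exact: Im_le_normC].
Qed.

Lemma ccontinuous_power_series (rho r : R) (A : R[i] -> R[i]) (c : nat -> R[i])
    (g : R -> R[i]) (s : R) :
  has_power_series rho A c -> 0 < r < rho ->
  (\forall x \near s, `|g x| <= r%:C) -> ccontinuous g s ->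
  ccontinuous (fun x => A (g x)) s.
Proof.
move=> HA rr gr cg.
have P (N : nat) : ccontinuous (fun x => \sum_(n < N) c n * g x ^+ n) s.
  apply: (ccontinuous_sum (f := fun n x => c n * g x ^+ n)) => n.
  by apply: ccontinuousM; [exact: ccontinuous_cst|exact: ccontinuousX].
have gs := nbhs_singleton gr.
split; apply/cvgrPdist_lt => e e0; have e3 : 0 < e / 3 by lra.
  have [N HN] := power_series_uniform HA rr e3.
  have [/cvgrPdist_lt /(_ _ e3) cP _] := P N.
  near=> x.
  have gx : `|g x| <= r%:C by near: x.
  have := Re_le_normC (ltW (HN _ gs)); have := Re_le_normC (ltW (HN _ gx)).
  have : `|Re (\sum_(n < N) c n * g s ^+ n) - Re (\sum_(n < N) c n * g x ^+ n)| < e / 3.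
    by near: x.
  rewrite !ReD !ReN !ltr_norml !ler_norml => /andP[? ?] /andP[? ?] /andP[? ?].
  by apply/andP; split; lra.
have [N HN] := power_series_uniform HA rr e3.
have [_ /cvgrPdist_lt /(_ _ e3) cP] := P N.
near=> x.
have gx : `|g x| <= r%:C by near: x.
have := Im_le_normC (ltW (HN _ gs)); have := Im_le_normC (ltW (HN _ gx)).
have : `|Im (\sum_(n < N) c n * g s ^+ n) - Im (\sum_(n < N) c n * g x ^+ n)| < e / 3.
  by near: x.
rewrite !ImD !ImN !ltr_norml !ler_norml => /andP[? ?] /andP[? ?] /andP[? ?].
by apply/andP; split; lra.
Unshelve. all: by end_near. Qed.

Section Kernel.
Variables (L alpha rho : R) (beta : R[i]) (A : R[i] -> R[i]) (c : nat -> R[i]).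
Hypotheses (L0 : 0 < L) (beta0 : 0 <= Re beta) (Lrho : L `^ Re beta < rho).
Hypothesis HA : has_power_series rho A c.

(** The midpoint leaves room on both sides: r < rho gives uniform convergence on the closed disc of
    radius r, and [cpow x beta] stays in that disc for x near any s in ]0, L], even for s = L. *)
Let r := (L `^ Re beta + rho) / 2.

Let r_bounds : [/\ 0 < r, r < rho & L `^ Re beta < r].
Proof.
move: (powR_gt0 (Re beta) L0) Lrho; rewrite /r; set P := L `^ _ => P0 Pr.
by split; lra.
Qed.

Let cpow_le (s : R) : 0 < s <= L -> `|cpow s beta| <= (L `^ Re beta)%:C.
Proof.
move=> /andP[s0 sL]; rewrite normC_cpow lecR.
by apply: ge0_ler_powR => //; rewrite nnegrE ltW.
Qed.

Lemma kernel_ccontinuous (s : R) : 0 < s <= L -> ccontinuous (Defs.kernel alpha beta A) s.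
Proof.
move=> sL; have [r0 rrho Lr] := r_bounds; have s0 : 0 < s by case/andP: sL.
apply: ccontinuousM; first by apply: ccontinuous_real; exact: powR_continuous.
apply: (@ccontinuous_power_series rho r A c) => //; first by rewrite r0.
  have : s `^ Re beta < r.
    by rewrite (le_lt_trans _ Lr)// -lecR -normC_cpow; exact: cpow_le.
  move=> sr.
  have /cvgrPdist_lt /(_ (r - s `^ Re beta)) H := @powR_continuous (Re beta) s s0.
  have d0 : 0 < r - s `^ Re beta by rewrite subr_gt0.
  near=> x; rewrite normC_cpow lecR.
  have : `|s `^ Re beta - x `^ Re beta| < r - s `^ Re beta by near: x; exact: H.
  by rewrite ltr_norml => /andP[? _]; lra.
exact: ccontinuous_cpow.
Unshelve. all: by end_near. Qed.

(** A is bounded on the disc of radius [r], so the kernel is dominated by a multiple of s^(alpha -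
    1), whose exponent exceeds -1. *)
Lemma kernel_integrable : 0 < alpha ->
  mu.-integrable `]0, L] (EFin \o (fun s => Re (Defs.kernel alpha beta A s))) /\
  mu.-integrable `]0, L] (EFin \o (fun s => Im (Defs.kernel alpha beta A s))).
Proof.
move=> alpha0; have [r0 rrho Lr] := r_bounds.
have [M HM] : exists M : R, forall z, `|z| <= r%:C -> `|Re (A z)| <= M /\ `|Im (A z)| <= M.
  by apply: (power_series_bounded HA); rewrite r0.
have ip : mu.-integrable `]0, L] (EFin \o (fun s => s `^ (alpha - 1))).
  by apply: integrable_powR => //; lra.
have bound (part : R[i] -> R) :
    (forall (x : R) z, part (x%:C * z) = x * part z) ->
    (forall s, 0 < s <= L -> {for s, continuous (fun s => part (Defs.kernel alpha beta A s))}) ->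
    (forall z, `|z| <= r%:C -> `|part (A z)| <= M) ->
    mu.-integrable `]0, L] (EFin \o (fun s => part (Defs.kernel alpha beta A s))).
  move=> partM cpart partA.
  apply: (@le_integrable _ _ R mu `]0, L]%classic _ _
    (EFin \o (fun s => M * s `^ (alpha - 1)))) => //.
  - apply/measurable_EFinP; apply: subspace_continuous_measurable_fun => //.
    by apply: continuous_in_subspaceT => s; rewrite inE/= in_itv/=; exact: cpart.
  - move=> s; rewrite /= in_itv/= => sL; rewrite lee_fin.
    rewrite /Defs.kernel partM normrM [in leRHS]normrM mulrC ler_wpM2r//.
    rewrite (le_trans (partA _ _)) ?ler_norm// (le_trans (cpow_le sL))//.
    by rewrite lecR ltW.
  - apply: (@integrable_boundedM _ _ (fun=> M) _ `|M|) => //.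
split; apply: bound.
- exact: ReMl.
- by move=> s sL; have [] := kernel_ccontinuous sL.
- by move=> z zr; have [] := HM z zr.
- exact: ImMl.
- by move=> s sL; have [] := kernel_ccontinuous sL.
- by move=> z zr; have [] := HM z zr.
Qed.

End Kernel.

(** By convention 0 to any nonzero power is 0, negative powers included, so the kernel takes the
    value 0 at its singularity. *)
Lemma kernel0 (alpha : R) beta (A : R[i] -> R[i]) : alpha != 1 -> Defs.kernel alpha beta A 0 = 0.
Proof. by move=> a1; rewrite /Defs.kernel powR0 ?subr_eq0// mul0r. Qed.

End ComplexKernels.

(** * Reduction to real and imaginary parts *)

Section Reduction.
Variable R : realType.
Local Notation mu := (@lebesgue_measure R).
Local Notation Re := (@complex.Re R).
Local Notation Im := (@complex.Im R).

Lemma derivative_on_parts (a b : R) (f : R -> R[i]) (t : R) (d : R[i]) :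
  (fun s => (s - t)^-1 * (Re (f s) - Re (f t))) @ within `[a, b] t^' --> Re d ->
  (fun s => (s - t)^-1 * (Im (f s) - Im (f t))) @ within `[a, b] t^' --> Im d ->
  derivative_on a b f t d.
Proof.
move=> /cvgrPdist_lt Hr /cvgrPdist_lt Hi; apply/cvgrPdist_lt => e e0.
have [e1 eE] : 0 < Re e /\ e = (Re e)%:C.
  by move: e0; case: e => x y; rewrite ltcE /= => /andP[/eqP -> x0].
have e2 : 0 < Re e / 2 by lra.
near=> s; rewrite eE; apply: normC_lt.
  have : `|Re d - (s - t)^-1 * (Re (f s) - Re (f t))| < Re e / 2 by near: s; exact: Hr.
  by rewrite ReD ReN ReMl ReD ReN.
have : `|Im d - (s - t)^-1 * (Im (f s) - Im (f t))| < Re e / 2 by near: s; exact: Hi.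
by rewrite ImD ImN ImMl ImD ImN.
Unshelve. all: by end_near. Qed.

Lemma Gamma_inverse_order (alpha : R) (beta : R[i]) (c cbar : nat -> R[i]) :
  Gamma_inverse alpha beta c cbar -> alpha != 0 /\ alpha != 1.
Proof.
move=> /(_ 0%N); rewrite big_ord_recl big_ord0 addr0 /Gamma_coef /= mulr0 !add0r => H.
have G0 : Gamma ((0 : R)%:C : R[i]) = 0 by exact: Gamma0.
split; apply/eqP => E; move: H; rewrite E ?subrr G0 !(mulr0, mul0r) => /esym/eqP;
  by rewrite oner_eq0.
Qed.

(** Reflection sends ]0, b - a] to [a, b[; the value [f 0 = 0] takes care of the remaining end point
    t = b. *)
Lemma integrable_reflected (a b : R) (f : R -> R) : f 0 = 0 ->
  mu.-integrable `]0, (b - a)] (EFin \o f) ->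
  mu.-integrable `[a, b] (EFin \o (fun t => f (b - t))).
Proof.
move=> f0 fi; apply: (integrable_indicM _ (measurable_itv _)).2.
have := integrable_reflect b ((integrable_indicM f (measurable_itv _)).1 fi).
congr (_.-integrable _ _); apply/funext => t /=; congr (_%:E).
rewrite !indicE !mem_setE !in_itv/= lerD2l lerN2.
have [->|tb] := eqVneq t b; first by rewrite subrr f0 !mulr0.
by rewrite subr_gt0 lt_neqAle tb andbC.
Qed.

Lemma weight_regular (a b alpha rho : R) (beta : R[i]) (A : R[i] -> R[i]) (c : nat -> R[i])
    (part : R[i] -> R) :
  (part = Re \/ part = Im) -> a < b -> 0 < alpha -> alpha != 1 -> 0 <= Re beta ->
  (b - a) `^ Re beta < rho -> has_power_series rho A c ->
  mu.-integrable `[a, b] (EFin \o (fun t => part (weight b alpha beta A t))) /\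
  (forall t : R, a <= t < b -> {for t, continuous (fun t => part (weight b alpha beta A t))}).
Proof.
move=> Hpart ab alpha0 alpha1 beta0 Lrho HA.
have L0 : 0 < b - a by rewrite subr_gt0.
(* A(1) may be non-real, so multiplication by [C] mixes the parts: each part of the weight is a real
   combination of both parts of the kernel. *)
pose C := (Gamma alpha%:C * A 1)^-1.
have [iRe iIm] := kernel_integrable L0 beta0 Lrho HA alpha0.
have K0 := kernel0 beta A alpha1.
have iRe' := @integrable_reflected a b (fun s => Re (Defs.kernel alpha beta A s))
  (congr1 Re K0) iRe.
have iIm' := @integrable_reflected a b (fun s => Im (Defs.kernel alpha beta A s))
  (congr1 Im K0) iIm.
have scale (f : R -> R) (k : R) : mu.-integrable `[a, b] (EFin \o f) ->
    mu.-integrable `[a, b] (EFin \o (fun t => k * f t)).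
  by move=> ifi; apply: (@integrable_boundedM _ _ (fun=> k) _ `|k|).
split; last first.
  move=> t /andP[at_ tb].
  have H : ccontinuous (fun t => weight b alpha beta A t) t.
    apply: ccontinuousM; last exact: ccontinuous_cst.
    have btL : 0 < b - t <= b - a by apply/andP; split; lra.
    have [kr ki] := kernel_ccontinuous alpha L0 beta0 Lrho HA btL.
    have cb : {for t, continuous (fun t => b - t)}.
      by apply: cvgB; [exact: cvg_cst|exact: cvg_id].
    split.
      by apply: (@continuous_comp _ _ _ (fun t => b - t)
        (fun s => Re (Defs.kernel alpha beta A s))).
    by apply: (@continuous_comp _ _ _ (fun t => b - t)
      (fun s => Im (Defs.kernel alpha beta A s))).
  by case: Hpart => ->; case: H.
case: Hpart => ->.
- rewrite (_ : EFin \o _ =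
    (EFin \o (fun t => Re C * Re (Defs.kernel alpha beta A (b - t)))) \+
    (EFin \o (fun t => - Im C * Im (Defs.kernel alpha beta A (b - t))))).
    by apply: integrableD => //; [exact: (scale _ (Re C) iRe')|exact: (scale _ (- Im C) iIm')].
  by apply/funext => t /=; rewrite /weight ReM -/C -EFinD; congr (_%:E); ring.
- rewrite (_ : EFin \o _ =
    (EFin \o (fun t => Im C * Re (Defs.kernel alpha beta A (b - t)))) \+
    (EFin \o (fun t => Re C * Im (Defs.kernel alpha beta A (b - t))))).
    by apply: integrableD => //; [exact: (scale _ (Im C) iRe')|exact: (scale _ (Re C) iIm')].
  by apply/funext => t /=; rewrite /weight ImM -/C -EFinD; congr (_%:E); ring.
Qed.

End Reduction.

Theorem corollary17 (R : realType) (n : nat) (a b alpha : R) (beta : R[i])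
    (rho rhobar : R) (A Abar : R[i] -> R[i]) (c cbar : nat -> R[i])
    (L : R -> 'rV[R]_n -> 'rV[R]_n -> R) (xa xb : 'rV[R]_n)
    (x : R -> 'rV[R]_n) :
  a < b ->
  0 <= alpha <= 1 ->
  0 <= complex.Re beta ->
  0 < rho -> (b - a) `^ complex.Re beta < rho ->
  has_power_series rho A c ->
  0 < rhobar -> (b - a) `^ complex.Re beta < rhobar ->
  has_power_series rhobar Abar cbar ->
  Gamma_inverse alpha beta c cbar ->
  (forall s : R, 0 < s <= b - a -> complex.Im (Abar (cpow s beta)) = 0) ->
  PC1_lagrangian a b L ->
  is_solution a b alpha beta A Abar L xa xb x ->
  let w := weight b alpha beta A in
  let u := caputo_real a alpha beta Abar x in
  forall t : R, a <= t < b ->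
    exists2 d : 'rV[R[i]]_n,
      is_RL_right a b alpha beta Abar
        (fun s => w s *: map_mx (real_complex R) (gradu L s (x s) (u s))) t d &
      d + w t *: map_mx (real_complex R) (gradx L t (x t) (u t)) = 0.
Proof.
move=> ab /andP[alpha0 alpha1] beta0 rho0 Lrho HA rhob0 Lrhob HAb HG HIm PL.
move=> [[Px xa_ xb_] xmax] w u t tab.
have [a0 a1] := Gamma_inverse_order HG.
have alpha_gt0 : 0 < alpha by rewrite lt_neqAle eq_sym a0.
have alpha_lt1 : alpha < 1 by rewrite lt_neqAle a1.
have L0 : 0 < b - a by rewrite subr_gt0.
pose kc := Defs.kernel (1 - alpha) beta Abar.
pose k s := complex.Re (kc s).
have kc0 : kc 0 = 0.
  by apply: kernel0; apply/eqP => E; move/eqP: a0; apply; lra.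
have k0 : k 0 = 0 by rewrite /k kc0.
have alpha1_gt0 : 0 < 1 - alpha by lra.
have [ik _] := kernel_integrable L0 beta0 Lrhob HAb alpha1_gt0.
have ck (r : R) : 0 < r <= b - a -> {for r, continuous k}.
  by move=> rL; have [] := kernel_ccontinuous (1 - alpha) L0 beta0 Lrhob HAb rL.
(* The reality assumption speaks of lags in ]0, b - a]; at the lag 0 the whole kernel is 0. *)
have kim (r : R) : 0 <= r <= b - a -> complex.Im (kc r) = 0.
  move=> /andP[]; rewrite le_eqVlt => /predU1P[<- _|r0 rL]; first by rewrite kc0.
  by rewrite /kc /Defs.kernel ImMl HIm ?mulr0// r0.
have uE (y : R -> 'rV[R]_n) s :
    caputo_real a alpha beta Abar y s = memory_derivative a k y s.
  apply/rowP => j; rewrite !mxE /left_integral /=.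
  by apply: eq_Rintegral => r _; rewrite ReMr.
have main (part : R[i] -> R) : (part = @complex.Re R \/ part = @complex.Im R) ->
    forall i : 'I_n,
    (fun s => (s - t)^-1 *
     (\int[lebesgue_measure]_(r in `[s, b]) (k (r - s) * (part (w r) * gradu L r (x r) (u r) 0 i)) -
      \int[lebesgue_measure]_(r in `[t, b]) (k (r - t) * (part (w r) * gradu L r (x r) (u r) 0 i))))
    @ within `[a, b] t^' --> part (w t) * gradx L t (x t) (u t) 0 i.
  move=> Hpart i.
  have [iw cw] := weight_regular Hpart ab alpha_gt0 a1 beta0 Lrho HA.
  have uE' : u = memory_derivative a k x by apply/funext => s; exact: uE.
  rewrite uE'.
  pose J (y : R -> 'rV[R]_n) := \int[lebesgue_measure]_(t in `[a, b])
    (part (w t) * L t (y t) (memory_derivative a k y t)).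
  have JE y : J y = part (functional a b alpha beta A Abar L y).
    rewrite /J /functional; case: Hpart => -> /=; apply: eq_Rintegral => s _.
      by rewrite ReMr uE.
    by rewrite ImMr uE.
  suff ymax y : PC1_curve a b y -> y a = x a -> y b = x b -> J y <= J x.
    exact: (real_euler_lagrange ab k0 ik ck iw cw PL Px ymax tab).
  move=> Py ya yb.
  have := xmax y (And3 Py (etrans ya xa_) (etrans yb xb_)).
  rewrite (JE y) (JE x).
  move: (functional a b alpha beta A Abar L y) (functional a b alpha beta A Abar L x).
  move=> Fy Fx; rewrite lecE => /andP[/eqP Eim Ele].
  by case: Hpart => ->; rewrite ?Eim.
(* The equation leaves no other choice for d, and the minus sign in [is_RL_right] turns the goal
   into convergence to + w dL/dx_i. *)
exists (- (w t *: map_mx (real_complex R) (gradx L t (x t) (u t)))); last by rewrite addNr.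
move=> i.
have -> : - (- (w t *: map_mx (real_complex R) (gradx L t (x t) (u t)))) 0 i =
    w t * (gradx L t (x t) (u t) 0 i)%:C.
  by rewrite mxE opprK mxE [X in _ * X]mxE.
(* The kernel and the gradient are real, so taking a part of the integral amounts to taking that
   part of the weight. *)
have RE (part : R[i] -> R) (s : R) : (part = @complex.Re R \/ part = @complex.Im R) ->
   a <= s <= b ->
   part (right_integral b (1 - alpha) beta Abar (fun s0 : R =>
     (w s0 *: map_mx (real_complex R) (gradu L s0 (x s0) (u s0))) 0 i) s) =
   \int[lebesgue_measure]_(r in `[s, b])
     (k (r - s) * (part (w r) * gradu L r (x r) (u r) 0 i)).
  move=> Hpart /andP[as_ sb]; rewrite /right_integral /Cintegral.
  have kim' (r : R) : r \in `[s, b]%classic -> complex.Im (kc (r - s)) = 0.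
    by rewrite inE/= in_itv/= => /andP[sr rb]; apply: kim; apply/andP; split; lra.
  case: Hpart => -> /=; apply: eq_Rintegral => r rsb; rewrite !mxE -/kc.
    by rewrite ReM kim'// mul0r subr0 ReMr.
  by rewrite ImM kim'// mul0r addr0 ImMr.
have tab' : a <= t <= b by case/andP: tab => -> /ltW.
apply: derivative_on_parts.
- rewrite ReMr; have := main _ (or_introl erefl) i.
  apply: cvg_trans; apply: near_eq_cvg; rewrite near_withinE; near=> s.
  move=> sab0; have sab : a <= s <= b by move: sab0; rewrite /= in_itv.
  congr (_ * (_ - _)).
    exact (esym (RE _ s (or_introl erefl) sab)).
  exact (esym (RE _ t (or_introl erefl) tab')).
- rewrite ImMr; have := main _ (or_intror erefl) i.
  apply: cvg_trans; apply: near_eq_cvg; rewrite near_withinE; near=> s.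
  move=> sab0; have sab : a <= s <= b by move: sab0; rewrite /= in_itv.
  congr (_ * (_ - _)).
    exact (esym (RE _ s (or_intror erefl) sab)).
  exact (esym (RE _ t (or_intror erefl) tab')).
Unshelve. all: by end_near. Qed.
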